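(* Let $\mathbb{F}$ be a field, and let $P$ and $Q$ be finite ranked posets, each having a unique minimal element. Then the Hilbert series of the splitting algebra $A(P\times Q)$ over $\mathbb{F}$ of the direct product $P\times Q$ is $$H(A(P\times Q),z)=\frac{1-z}{1-z\,\mathcal{M}_P(z)\,\mathcal{M}_Q(z)}.$$
   Context: Here $\mathbb{N}$ includes $0$. In a poset, $p\lessdot q$ ($q$ covers $p$) means $p<q$ and any $r$ with $p\leq r\leq q$ equals $p$ or $q$. A ranked poset is a poset $P$ with a rank function $|\cdot|:P\to\mathbb{N}$ such that $|p|=0$ if and only if $p$ is minimal, and $p\lessdot q$ implies $|q|=|p|+1$. The direct product of $P$ and $Q$ is $P\times Q$ with $(p,q)\leq(p',q')$ if and only if $p\leq p'$ and $q\leq q'$, and rank $|(p,q)|=|p|_P+|q|_Q$. The Möbius function $\mu$ of a finite poset is given by $\mu(p,p)=1$, $\mu(p,q)=-\sum_{p\leq r<q}\mu(p,r)$ for $p<q$, and $\mu(p,q)=0$ if $p\not\leq q$. The Möbius polynomial is $\mathcal{M}_P(z)=\sum_{p\leq q}\mu(p,q)z^{|q|-|p|}$, the sum over all pairs $(p,q)\in P\times P$ with $p\leq q$. Splitting algebra: for a finite ranked poset $P$, the Hasse diagram is the directed graph with vertex set $P$ and edge set $E_P=\{(q,p):p\lessdot q\}$; the edge $e=(q,p)$ has tail $t(e)=q$ and head $h(e)=p$. A path is a tuple $\pi=(e_1,\dots,e_n)$ of edges with $h(e_i)=t(e_{i+1})$ for $1\leq i<n$; put $t(\pi)=t(e_1)$,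 $h(\pi)=h(e_n)$. Write $\pi_1\approx\pi_2$ if $t(\pi_1)=t(\pi_2)$ and $h(\pi_1)=h(\pi_2)$. Let $\mathbb{F}\langle E_P\rangle$ be the free associative unital algebra on $E_P$. To each path $\pi=(e_1,\dots,e_n)$ associate the polynomial $(t-e_1)(t-e_2)\cdots(t-e_n)=\sum_{i\geq 0}e(\pi,i)t^i$ in $\mathbb{F}\langle E_P\rangle[t]$, with $t$ a central variable. Then $A(P)=\mathbb{F}\langle E_P\rangle/R$, where $R$ is the two-sided ideal generated by all $e(\pi_1,i)-e(\pi_2,i)$ with $\pi_1\approx\pi_2$ and $i\geq 0$. The ideal $R$ is homogeneous, so $A(P)$ inherits a grading in which every edge has degree $1$. The Hilbert series of a graded algebra $A=\bigoplus_{i\geq0}A_i$ is $H(A,z)=\sum_{i\geq0}\dim(A_i)z^i$. *)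

(* Defs.v *)
From HB Require Import structures.
From mathcomp Require Import all_boot all_order all_algebra.
From mathcomp Require Import boolp.
From mathcomp Require Import finmap monalg.

Set Implicit Arguments.
Unset Strict Implicit.
Unset Printing Implicit Defensive.

Import Order.TTheory GRing.Theory.
Local Open Scope ring_scope.

Definition minimal d (T : porderType d) (p : T) : Prop :=
  forall q : T, (q <= p)%O -> q = p.

Definition covers d (T : finPOrderType d) (p q : T) : bool :=
  ((p < q)%O && [forall r, (p <= r <= q)%O ==> (r == p) || (r == q)]).

HB.mixin Record isRanked d T of Order.FinPOrder d T := {
  rank : T -> nat;
  rank_eq0 : forall p : T, rank p = 0%N <-> minimal p;
  rank_covers : forall p q : T, covers p q -> rank q = (rank p).+1
}.

#[short(type="finRankedPOrderType")]
HB.structure Definition FinRankedPOrder d :=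
  { T of Order.FinPOrder d T & isRanked d T }.

Section ProductRank.
Context (d1 d2 : Order.disp_t).
Variables (P : finRankedPOrderType d1) (Q : finRankedPOrderType d2).

Definition prod_rank (x : P *p Q) : nat := (rank x.1 + rank x.2)%N.

Lemma prod_rank_eq0 (x : P *p Q) : prod_rank x = 0%N <-> minimal x.
Proof.
case: x => p q; rewrite /prod_rank /=; split.
  move/eqP; rewrite addn_eq0 => /andP[/eqP/rank_eq0 mp /eqP/rank_eq0 mq].
  by case=> p' q' /andP[/= /mp -> /mq ->].
move=> mpq; apply/eqP; rewrite addn_eq0; apply/andP; split; apply/eqP/rank_eq0.
  move=> p' lep'; have /mpq[//] : (((p', q) : P *p Q) <= (p, q))%O.
  by rewrite leEprod /= lep' lexx.
move=> q' leq'; have /mpq[//] : (((p, q') : P *p Q) <= (p, q))%O.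
by rewrite leEprod /= leq' lexx.
Qed.

Lemma prod_rank_covers (x y : P *p Q) :
  covers x y -> prod_rank y = (prod_rank x).+1.
Proof.
case: x y => [p q] [p' q'] /andP[ltxy /forallP cxy]; rewrite /prod_rank /=.
have /andP[/= lep leq] : (((p, q) : P *p Q) <= (p', q'))%O by exact: ltW.
have neq : ((p, q) : P *p Q) != (p', q') by rewrite (lt_eqF ltxy).
have := cxy (p', q); rewrite !leEprod /= lep leq !lexx /= => /orP[] /eqP[e].
  subst p'; rewrite -addnS; congr (_ + _)%N; apply: rank_covers.
  apply/andP; split; first by rewrite lt_neqAle leq andbT; apply: contra neq => /eqP->.
  apply/forallP=> r; apply/implyP=> /andP[h1 h2].
  have := cxy (p, r); rewrite !leEprod /= h1 h2 !lexx /=.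
  by case/orP=> /eqP[->]; rewrite eqxx ?orbT.
subst q'; rewrite -addSn; congr (_ + _)%N; apply: rank_covers.
apply/andP; split; first by rewrite lt_neqAle lep andbT; apply: contra neq => /eqP->.
apply/forallP=> r; apply/implyP=> /andP[h1 h2].
have := cxy (r, q); rewrite !leEprod /= h1 h2 !lexx /=.
by case/orP=> /eqP[->]; rewrite eqxx ?orbT.
Qed.

(* [P *p Q] unfolds to the type below, which carries the library's instances. *)
HB.instance Definition _ :=
  isRanked.Build _ (P *prod[Order.prod_display d1 d2] Q)
    prod_rank_eq0 prod_rank_covers.

End ProductRank.

Section Moebius.
Context (d : Order.disp_t) (P : finRankedPOrderType d).
Implicit Types p q r : P.

Fixpoint moebius_rec (n : nat) p q : int :=
  if p == q then 1
  else if (p < q)%O then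
    if n is m.+1 then - \sum_(r | (p <= r < q)%O) moebius_rec m p r else 0
  else 0.

(* The recursion depth #|P| is always sufficient: see [moebius_lt]. *)
Definition moebius p q : int := moebius_rec #|P| p q.

Lemma moebius_rec_stable n m p q :
  (#|[pred r | r < q]%O| <= n)%N -> (#|[pred r | r < q]%O| <= m)%N ->
  moebius_rec n p q = moebius_rec m p q.
Proof.
elim: n m q => [|n IH] [|m] q //=; case: ifP => // _; case: ifP => // ltpq.
- by rewrite leqn0 => /eqP/card0_eq/(_ p); rewrite inE ltpq.
- by move=> _; rewrite leqn0 => /eqP/card0_eq/(_ p); rewrite inE ltpq.
move=> hn hm; congr (- _); apply: eq_bigr => r /andP[_ ltrq].
have lt_card : (#|[pred s | s < r]%O| < #|[pred s | s < q]%O|)%N.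
  apply: proper_card; apply/properP; split.
    by apply/subsetP=> s; rewrite !inE => /lt_trans; apply.
  by exists r; rewrite !inE ?ltxx.
by apply: IH; rewrite -ltnS; apply: leq_trans lt_card _.
Qed.

Lemma moebius_id p : moebius p p = 1.
Proof. by rewrite /moebius; case: #|P| => [|n] /=; rewrite eqxx. Qed.

Lemma moebius_lt p q : (p < q)%O ->
  moebius p q = - \sum_(r | (p <= r < q)%O) moebius p r.
Proof.
move=> ltpq; rewrite /moebius (@moebius_rec_stable _ #|P|.+1) ?leqW ?max_card //=.
by rewrite (lt_eqF ltpq) ltpq.
Qed.

Lemma moebius_nle p q : ~~ (p <= q)%O -> moebius p q = 0.
Proof.
move=> nle; have npq : (p == q) = false by apply: contraNF nle => /eqP->.
have nlt : (p < q)%O = false by apply: contraNF nle => /ltW.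
by rewrite /moebius; case: #|P| => [|n] /=; rewrite npq nlt.
Qed.

(* The natural subtraction does not truncate: rank is increasing. *)
Definition moebius_poly : {poly int} :=
  \sum_(x : P * P | (x.1 <= x.2)%O) moebius x.1 x.2 *: 'X^(rank x.2 - rank x.1).

End Moebius.

Arguments moebius_poly {d} P.

Section HasseDiagram.
Context (d : Order.disp_t) (P : finRankedPOrderType d).

Definition edge := {e : P * P | covers e.2 e.1}.
Definition etail (e : edge) : P := (val e).1.
Definition ehead (e : edge) : P := (val e).2.

(* A (nonempty) path (e_1, ..., e_n) is given by its first edge e_1 and the
   sequence s of the remaining ones. *)
Definition hasse_path (e : edge) (s : seq edge) : bool :=
  path (fun e1 e2 => ehead e1 == etail e2) e s.

Lemma hasse_path_rank e s : hasse_path e s ->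
  rank (etail e) = (rank (ehead (last e s)) + (size s).+1)%N.
Proof.
have rank_edge (e' : edge) : rank (etail e') = (rank (ehead e')).+1.
  by apply: rank_covers; apply: (valP e').
elim: s e => [|e' s IH] e /=; first by rewrite addn1 rank_edge.
by case/andP=> /eqP hd /IH; rewrite -hd rank_edge => ->; rewrite [in RHS]addnS.
Qed.

End HasseDiagram.

Section GeneratedIdeal.
Variable R : nzRingType.

Definition two_sided_ideal (I : R -> Prop) : Prop :=
  [/\ I 0, forall x y, I x -> I y -> I (x - y),
      forall a x, I x -> I (a * x) & forall a x, I x -> I (x * a)].

Definition ideal_gen (S : R -> Prop) (x : R) : Prop :=
  forall I : R -> Prop, two_sided_ideal I -> (forall s, S s -> I s) -> I x.

Lemma ideal_gen_ideal S : two_sided_ideal (ideal_gen S).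
Proof.
split=> [I [] //|x y hx hy I iI sI|a x hx I iI sI|a x hx I iI sI];
  case: (iI) => _ hB hl hr.
- exact: hB (hx I iI sI) (hy I iI sI).
- exact: hl (hx I iI sI).
- exact: hr (hx I iI sI).
Qed.

End GeneratedIdeal.

Section SplittingAlgebra.
Context (F : fieldType) (d : Order.disp_t) (P : finRankedPOrderType d).

(* The free associative algebra on the edges: the monoid algebra over F of the
   free monoid {fmonom edge P}. *)
Local Notation free_alg := {malg F[{fmonom (edge P)}]}.

Definition edge_gen (e : edge P) : free_alg := << fmu e >>.

Definition path_poly (s : seq (edge P)) : {poly free_alg} :=
  \prod_(e <- s) ('X - (edge_gen e)%:P).

Definition splitting_rel (x : free_alg) : Prop :=
  exists e1 s1 e2 s2 (i : nat),
    [/\ hasse_path e1 s1 && hasse_path e2 s2,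
        etail e1 = etail e2, ehead (last e1 s1) = ehead (last e2 s2) &
        x = (path_poly (e1 :: s1))`_i - (path_poly (e2 :: s2))`_i].

Definition splitting_ideal : {pred free_alg} :=
  fun x => `[< ideal_gen splitting_rel x >].

Lemma splitting_ideal_zmod : zmod_closed splitting_ideal.
Proof.
have [h0 hB _ _] := ideal_gen_ideal splitting_rel.
by split=> [|x y /asboolP hx /asboolP hy]; apply/asboolP => //; apply: hB.
Qed.

HB.instance Definition _ :=
  GRing.isZmodClosed.Build free_alg splitting_ideal splitting_ideal_zmod.

Lemma splitting_idealMl a x : x \in splitting_ideal -> a * x \in splitting_ideal.
Proof.
have [_ _ h _] := ideal_gen_ideal splitting_rel.
by move=> /asboolP hx; apply/asboolP; apply: h.
Qed.

Lemma splitting_idealMr a x : x \in splitting_ideal -> x * a \in splitting_ideal.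
Proof.
have [_ _ _ h] := ideal_gen_ideal splitting_rel.
by move=> /asboolP hx; apply/asboolP; apply: h.
Qed.

Lemma splitting_idealZ (c : F) x :
  x \in splitting_ideal -> c *: x \in splitting_ideal.
Proof. by rewrite -mul_malgC; apply: splitting_idealMl. Qed.

Lemma path_poly_coef1 s i :
  ((path_poly s)`_i : free_alg)@_mone = (i == size s)%:R.
Proof.
pose h : {rmorphism free_alg -> F} := mcoeff mone.
rewrite -[LHS]/(h _) -coef_map /path_poly rmorph_prod /=.
under eq_bigr do rewrite rmorphB /= map_polyX map_polyC /= mcoeffU.
have -> : \prod_(e <- s) ('X - (1 *+ (fmu e == mone :> {fmonom (edge P)}))%:P)
    = 'X^(size s) :> {poly F}.
  elim: s => [|e s IH]; first by rewrite big_nil expr0.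
  rewrite big_cons IH exprS; congr (_ * _).
  by rewrite -val_eqE /= fmU fm1 mulr0n subr0.
by rewrite coefXn.
Qed.

(* Paths with the same ends have the same length since P is ranked, so the
   relations have no constant term and the quotient is a nonzero ring. *)
Lemma splitting_ideal_coef1 x : x \in splitting_ideal -> x@_mone = 0.
Proof.
move=> /asboolP hx; apply: (hx (fun y : free_alg => y@_mone = 0)); last first.
  move=> _ [e1 [s1 [e2 [s2 [i [/andP[p1 p2] et eh ->]]]]]].
  rewrite mcoeffB !path_poly_coef1 /=.
  have /addnI -> := etrans (esym (hasse_path_rank p1))
    (etrans (congr1 rank et) (etrans (hasse_path_rank p2)
      (congr1 (fun p => (rank p + _)%N) (esym eh)))).
  by rewrite subrr.
split=> [|u v|a u|a u]; first by rewrite mcoeff0.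
- by rewrite mcoeffB => -> ->; rewrite subrr.
- by rewrite (rmorphM (mcoeff mone : free_alg -> F)) /= => ->; rewrite mulr0.
- by rewrite (rmorphM (mcoeff mone : free_alg -> F)) /= => ->; rewrite mul0r.
Qed.

Definition splitting_algebra := {ideal_quot splitting_ideal}.

HB.instance Definition _ := GRing.Zmodule.on splitting_algebra.
HB.instance Definition _ := EqQuotient.on splitting_algebra.

Local Open Scope quotient_scope.

(* The class of x in A(P). *)
Definition sa_pi (x : free_alg) : splitting_algebra := \pi_splitting_algebra x.

Lemma sa_pi_eq x y : (sa_pi x = sa_pi y) <-> (x - y \in splitting_ideal).
Proof.
rewrite -[x - y \in _]/(Quotient.equiv splitting_ideal x y).
rewrite /sa_pi; split; [move/eqP; rewrite piE //|move=> ?; apply/eqP; rewrite piE //].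
Qed.

Lemma sa_piK a : sa_pi (repr a) = a.
Proof. exact: reprK. Qed.

Lemma sa_piD x y : sa_pi (x + y) = sa_pi x + sa_pi y.
Proof. by rewrite /sa_pi !piE. Qed.

Definition sa_one : splitting_algebra := sa_pi 1.
Definition sa_mul (a b : splitting_algebra) : splitting_algebra :=
  sa_pi (repr a * repr b).
Definition sa_scale (c : F) (a : splitting_algebra) : splitting_algebra :=
  sa_pi (c *: repr a).

Lemma sa_piM x y : sa_mul (sa_pi x) (sa_pi y) = sa_pi (x * y).
Proof.
apply/sa_pi_eq; set x' := repr _; set y' := repr _.
have -> : x' * y' - x * y = (x' - x) * y' + x * (y' - y).
  by rewrite mulrBl mulrBr addrA subrK.
apply: rpredD; [apply: splitting_idealMr|apply: splitting_idealMl];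
  by apply/sa_pi_eq; rewrite sa_piK.
Qed.

Lemma sa_piZ c x : sa_scale c (sa_pi x) = sa_pi (c *: x).
Proof.
apply/sa_pi_eq; rewrite -scalerBr; apply: splitting_idealZ.
by apply/sa_pi_eq; rewrite sa_piK.
Qed.

Lemma sa_mulA : associative sa_mul.
Proof.
by move=> a b c; rewrite -[a]sa_piK -[b]sa_piK -[c]sa_piK !sa_piM mulrA.
Qed.

Lemma sa_mul1 : left_id sa_one sa_mul.
Proof. by move=> a; rewrite -[a]sa_piK sa_piM mul1r. Qed.

Lemma sa_mulr1 : right_id sa_one sa_mul.
Proof. by move=> a; rewrite -[a]sa_piK sa_piM mulr1. Qed.

Lemma sa_mulDl : left_distributive sa_mul +%R.
Proof.
move=> a b c; rewrite -[a]sa_piK -[b]sa_piK -[c]sa_piK.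
by rewrite -sa_piD !sa_piM mulrDl sa_piD.
Qed.

Lemma sa_mulDr : right_distributive sa_mul +%R.
Proof.
move=> a b c; rewrite -[a]sa_piK -[b]sa_piK -[c]sa_piK.
by rewrite -sa_piD !sa_piM mulrDr sa_piD.
Qed.

Lemma sa_one_neq0 : sa_one != 0.
Proof.
apply/eqP; have -> : 0 = sa_pi 0 by rewrite /sa_pi !piE.
move/sa_pi_eq; rewrite subr0 => /splitting_ideal_coef1/eqP.
by rewrite mcoeff1 eqxx oner_eq0.
Qed.

HB.instance Definition _ := GRing.Zmodule_isNzRing.Build splitting_algebra
  sa_mulA sa_mul1 sa_mulr1 sa_mulDl sa_mulDr sa_one_neq0.

Lemma sa_scaleA b c a : sa_scale b (sa_scale c a) = sa_scale (b * c) a.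
Proof. by rewrite -[a]sa_piK !sa_piZ scalerA. Qed.

Lemma sa_scale1 : left_id 1 sa_scale.
Proof. by move=> a; rewrite -[a]sa_piK sa_piZ scale1r. Qed.

Lemma sa_scaleDr : right_distributive sa_scale +%R.
Proof.
by move=> c a b; rewrite -[a]sa_piK -[b]sa_piK -sa_piD !sa_piZ scalerDr sa_piD.
Qed.

Lemma sa_scaleDl a : {morph sa_scale^~ a : b c / b + c}.
Proof. by move=> b c; rewrite -[a]sa_piK !sa_piZ scalerDl sa_piD. Qed.

HB.instance Definition _ := GRing.Zmodule_isLmodule.Build F splitting_algebra
  sa_scaleA sa_scale1 sa_scaleDr sa_scaleDl.

Lemma sa_scaleAl c (a b : splitting_algebra) : c *: (a * b) = c *: a * b.
Proof.
rewrite -[a]sa_piK -[b]sa_piK.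
change (sa_scale c (sa_mul (sa_pi (repr a)) (sa_pi (repr b))) =
  sa_mul (sa_scale c (sa_pi (repr a))) (sa_pi (repr b))).
by rewrite sa_piM !sa_piZ sa_piM scalerAl.
Qed.

HB.instance Definition _ :=
  GRing.Lmodule_isLalgebra.Build F splitting_algebra sa_scaleAl.

Lemma free_alg_scaleAr c (x y : free_alg) : c *: (x * y) = x * (c *: y).
Proof.
rewrite [x * y]malgME [RHS](malgMEw (fsubset_refl _) (msuppZ_le c y)).
rewrite scaler_sumr; apply: eq_bigr => k1 _.
rewrite scaler_sumr; apply: eq_bigr => k2 _.
by apply/malgP => k; rewrite mcoeffZ !mcoeffU mcoeffZ mulrnAr mulrCA.
Qed.

Lemma sa_scaleAr c (a b : splitting_algebra) : c *: (a * b) = a * (c *: b).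
Proof.
rewrite -[a]sa_piK -[b]sa_piK.
change (sa_scale c (sa_mul (sa_pi (repr a)) (sa_pi (repr b))) =
  sa_mul (sa_pi (repr a)) (sa_scale c (sa_pi (repr b)))).
by rewrite sa_piM !sa_piZ sa_piM free_alg_scaleAr.
Qed.

HB.instance Definition _ :=
  GRing.Lalgebra_isAlgebra.Build F splitting_algebra sa_scaleAr.

Definition homogeneous (n : nat) (x : free_alg) : Prop :=
  forall m, m \in msupp x -> fdeg m = n.

(* The n-th graded component of A(P): classes of homogeneous elements of degree n. *)
Definition splitting_component (n : nat) (a : splitting_algebra) : Prop :=
  exists2 x : free_alg, homogeneous n x & a = sa_pi x.

End SplittingAlgebra.

Arguments splitting_algebra F {d} P.
Arguments splitting_component F {d} P n a.

(* [has_dim S k]: the subspace S of V has a basis with k elements. *)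
Definition has_dim (F : fieldType) (V : lmodType F) (S : V -> Prop) (k : nat) :
    Prop :=
  exists b : 'I_k -> V,
    [/\ forall i, S (b i),
        forall c : 'I_k -> F, \sum_i c i *: b i = 0 -> forall i, c i = 0 &
        forall v, S v -> exists c : 'I_k -> F, v = \sum_i c i *: b i].

(* H(z) = \sum_n (H n) z^n is the Hilbert series of the graded space V = (+)_n V_n,
   whose components must in particular be finite-dimensional. *)
Definition is_hilbert_series (F : fieldType) (V : lmodType F)
    (comp : nat -> V -> Prop) (H : nat -> nat) : Prop :=
  forall n, has_dim (comp n) (H n).

(* h(z) = p(z) / q(z) in the ring Z[[z]] of formal power series, where q is
   invertible because q(0) = 1. *)
Definition is_series_quotient (h : nat -> int) (p q : {poly int}) : Prop :=
  q`_0 = 1 /\ forall n, \sum_(i < n.+1) q`_i * h (n - i)%N = p`_n.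

(* Main.v *)
Require Import Defs.
From HB Require Import structures.
From mathcomp Require Import all_boot all_order all_algebra.
From mathcomp Require Import boolp functions.
From mathcomp Require Import finmap monalg zify ring.

Set Implicit Arguments.
Unset Strict Implicit.
Unset Printing Implicit Defensive.

Import Order.TTheory GRing.Theory.
Local Open Scope ring_scope.

(** Let P be a finite ranked poset with a least element bot, and A = A(P). The
    heart of the matter is that H(A(P), z) = (1 - z) / (1 - z M_P(z)) for every
    such P (lemma [splitting_hilbert_series]); the theorem follows because
    P * Q is again of this kind and the Moebius function is multiplicative on
    products ([moebius_product]), hence so is the Moebius polynomial.

    For v in P let P_v(t) in A[t] be the product of the factors t - e along a
    path from v to bot; in A it depends on v only. Let sigma be the shift on
    sequences with values in A, and K_v the space of the sequences s with
    P_v(sigma) s = 0. Such an s is given by its first |v| values, which are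
    arbitrary, and K_w is contained in K_v for w <= v, since P_w is a right
    factor of P_v. For y in A let fund_v(y) be the element of K_v whose first
    |v| values are 0, ..., 0, y. When v covers w along the edge e, one has
        sigma fund_v(y) = fund_v(e y) + fund_w(y)         ([fundamental_shift])
    so that e y = fund_v(y)_|v| - fund_w(y)_|w|: the values s_|v|, for s in K_v,
    span the augmentation ideal A_+. They satisfy the obvious relations, that s
    in K_w has the same value s_|v| whether it is seen in K_v, or shifted
    |v| - |w| times and seen in K_w.

    There are no other relations ([extension_exists]): a family of functionals
    f_v on the K_v with f_v(s) = f_w(sigma s), for s in K_w and v covering w,
    comes from a functional on A_+. One defines it on the free algebra by
    e y |-> f_v(fund_v(y)) - f_w(fund_w(y)), and computes its values on
    the coefficients of a product (t - e_1) ... (t - e_n): they depend only on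
    the two ends of the path ([lifted_path_coef]).

    The spaces K_v are moreover in general position. Choose in each degree a
    complement M_v of the sum of the K_w, w < v, in K_v; then the sum of all the
    M_v is direct ([independentP]). This goes by induction on the degree: a
    relation of degree n among elements of the M_v, evaluated at the index r,
    where r is the largest rank that occurs in it, is a relation among the
    values s_|v|; a functional that separates the term of rank r from the lower
    K_w can be extended to a compatible family of functionals, because above
    rank r only degrees smaller than n occur ([glue_functionals]).

    Consequently K_v is the direct sum of the M_w for w <= v, and A_+ is the
    direct sum of the spaces of values s_|v| for s in M_v. Counting dimensions
    gives two families of linear relations between the dimensions of the graded
    components of A and those of the M_v ([splitting_dimensions]). Moebius
    inversion eliminates the latter; what remains is c = 1 + z M_P(z) c for the
    series c = H / (1 - z) of partial sums ([c_recursion]). *)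

(** * Subspaces of a vector space of arbitrary dimension *)

Section Subspaces.
Variables (F : fieldType) (V : lmodType F).
Implicit Types (S T U : V -> Prop).

Definition subspace S : Prop :=
  S 0 /\ forall (a : F) x y, S x -> S y -> S (a *: x + y).

Lemma subspace0 S : subspace S -> S 0. Proof. by case. Qed.

Lemma subspace_lin S a x y : subspace S -> S x -> S y -> S (a *: x + y).
Proof. by case=> _; apply. Qed.

Lemma subspaceD S x y : subspace S -> S x -> S y -> S (x + y).
Proof. by case=> _ h hx hy; rewrite -[x]scale1r; apply: h. Qed.

Lemma subspaceZ S a x : subspace S -> S x -> S (a *: x).
Proof. by case=> h0 h hx; rewrite -[_ *: _]addr0; apply: h. Qed.

Lemma subspaceB S x y : subspace S -> S x -> S y -> S (x - y).
Proof. by case=> _ h hx hy; rewrite addrC -scaleN1r; apply: h. Qed.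

Lemma subspace_sum S I (r : seq I) (P : pred I) (g : I -> V) :
  subspace S -> (forall i, P i -> S (g i)) -> S (\sum_(i <- r | P i) g i).
Proof.
by move=> sS hg; apply: big_ind => //; [apply: subspace0|move=> *; apply: subspaceD].
Qed.

Lemma subspace_eq0 : subspace (fun x : V => x = 0).
Proof. by split=> [//|a x y -> ->]; rewrite scaler0 addr0. Qed.

(** Functionals are only required to be linear on the subspace where they
    matter, so that none has to be extended to an infinite dimensional space. *)
Definition linear_on S (f : V -> F) : Prop :=
  forall (a : F) x y, S x -> S y -> f (a *: x + y) = a * f x + f y.

Lemma linear_on0 S f : subspace S -> linear_on S f -> f 0 = 0.
Proof.
move=> [S0 _] lf; have := lf (-1) 0 0 S0 S0.
by rewrite scaler0 addr0 mulN1r addNr.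
Qed.

Lemma linear_onD S f x y : linear_on S f -> S x -> S y ->
  f (x + y) = f x + f y.
Proof. by move=> lf hx hy; have := lf 1 x y hx hy; rewrite scale1r mul1r. Qed.

Lemma linear_onB S f x y : linear_on S f -> S x -> S y ->
  f (x - y) = f x - f y.
Proof.
by move=> lf hx hy; rewrite addrC -scaleN1r lf // mulN1r addrC.
Qed.

Lemma linear_onZ S f a x : subspace S -> linear_on S f -> S x ->
  f (a *: x) = a * f x.
Proof.
move=> sS lf hx; rewrite -[_ *: _]addr0 lf //; last exact: subspace0.
by rewrite (linear_on0 sS lf) addr0.
Qed.

Lemma linear_on_sum S f I (r : seq I) (P : pred I) (g : I -> V) :
  subspace S -> linear_on S f -> (forall i, P i -> S (g i)) ->
  f (\sum_(i <- r | P i) g i) = \sum_(i <- r | P i) f (g i).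
Proof.
move=> sS lf hg.
suff [_ ->] : S (\sum_(i <- r | P i) g i) /\
    f (\sum_(i <- r | P i) g i) = \sum_(i <- r | P i) f (g i) by [].
apply: (big_ind2 (fun x y => S x /\ f x = y)) => [|x1 x2 y1 y2 [h1 <-] [h2 <-]|i Pi].
- by split; [apply: subspace0|apply: linear_on0 lf].
- by split; [apply: subspaceD|apply: (linear_onD lf)].
- by split=> //; apply: hg.
Qed.

Definition finitely_spanned S : Prop :=
  exists k (b : 'I_k -> V), (forall i, S (b i)) /\
    forall x, S x -> exists c : 'I_k -> F, x = \sum_i c i *: b i.

Lemma has_dim_spanned S k : has_dim S k -> finitely_spanned S.
Proof. by case=> b [Sb _ hb]; exists k, b. Qed.

(** A smallest family of elements of S that spans S modulo U is free modulo U: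
    an element occurring in a relation could be dropped. *)
Lemma basis_mod S U : subspace S -> subspace U -> (forall x, U x -> S x) ->
  finitely_spanned S ->
  exists k (b : 'I_k -> V),
    [/\ forall i, S (b i),
        forall c : 'I_k -> F, U (\sum_i c i *: b i) -> forall i, c i = 0 &
        forall x, S x -> exists c : 'I_k -> F, U (x - \sum_i c i *: b i)].
Proof.
move=> sS sU US [k0 [b0 [Sb0 sp0]]].
pose Q k := `[< exists b : 'I_k -> V, (forall i, S (b i)) /\
  forall x, S x -> exists c : 'I_k -> F, U (x - \sum_i c i *: b i) >].
have exQ : exists k, Q k.
  exists k0; apply/asboolP; exists b0; split=> // x /sp0[c ->]; exists c.
  by rewrite subrr; apply: subspace0.
case: (ex_minnP exQ) => k /asboolP[b [Sb spb]] kmin.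
exists k, b; split=> // c Uc j; apply: contrapT => /eqP cj0.
case: k => [|k] in b Sb spb kmin c Uc j cj0 *; first by case: j {cj0}.
suff /kmin : Q k by rewrite ltnn.
apply/asboolP; exists (fun i => b (lift j i)); split=> // x /spb[d Ud].
(* Eliminate the j-th vector with the relation c. *)
exists (fun i => d (lift j i) - d j / c j * c (lift j i)).
have := subspaceD sU Ud (subspaceZ (d j / c j) sU Uc).
rewrite (bigD1_ord j) //= [in X in U (_ + X)](bigD1_ord j) //=.
rewrite scalerDr scalerA divfK //.
under [X in _ -> U (_ - X)]eq_bigr do rewrite scalerBl -scalerA.
rewrite sumrB -scaler_sumr opprB.
set A := \sum_(_ < _) _; set B := _ *: _; set C := _ *: _.
by rewrite [B + A]addrC opprD !addrA subrK addrAC -addrA.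
Qed.

Lemma has_dim_exists S : subspace S -> finitely_spanned S ->
  exists k, has_dim S k.
Proof.
move=> sS fS; have U0 x : x = 0 -> S x by move=> ->; apply: subspace0.
have [k [b [Sb fb sb]]] := basis_mod sS subspace_eq0 U0 fS.
exists k, b; split=> // v /sb[c /eqP]; rewrite subr_eq0 => /eqP ->.
by exists c.
Qed.

Lemma has_dim_ext S T k : (forall x, S x <-> T x) -> has_dim S k -> has_dim T k.
Proof.
move=> e [b [Sb fb sb]]; exists b; split=> // [i|v /e]; [exact/e|exact: sb].
Qed.

End Subspaces.

Section Dimension.
Variables (F : fieldType) (V : lmodType F).
Implicit Types (S T U M : V -> Prop).

Lemma subspace_complement S U : subspace S -> subspace U ->
  (forall x, U x -> S x) -> finitely_spanned S ->
  exists M k, [/\ subspace M, forall x, M x -> S x, has_dim M k,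
    forall x, S x -> exists u y, [/\ U u, M y & x = u + y] &
    forall x, U x -> M x -> x = 0].
Proof.
move=> sS sU US fS; have [k [b [Sb fb sb]]] := basis_mod sS sU US fS.
exists (fun x => exists c : 'I_k -> F, x = \sum_i c i *: b i), k; split.
- split=> [|a _ _ [c ->] [d ->]].
    by exists (fun=> 0); rewrite big1 // => i _; rewrite scale0r.
  exists (fun i => a * c i + d i); rewrite scaler_sumr -big_split /=.
  by apply: eq_bigr => i _; rewrite scalerDl scalerA.
- move=> _ [c ->]; apply: subspace_sum => // i _; exact: subspaceZ.
- exists b; split=> //.
  + move=> i; exists (fun j => (j == i)%:R); rewrite (bigD1 i) //= eqxx scale1r.
    by rewrite big1 ?addr0 // => j /negbTE ->; rewrite scale0r.
  + by move=> c c0; apply: fb; rewrite c0; apply: subspace0.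
- move=> x /sb[c Uc]; exists (x - \sum_i c i *: b i), (\sum_i c i *: b i).
  by split; [|exists c|rewrite subrK].
- move=> x Ux [c xE]; rewrite xE big1 // => i _.
  by rewrite (fb c) ?scale0r // -xE.
Qed.

(** A coordinate with respect to a basis of S modulo U. *)
Lemma separating_functional S U z : subspace S -> subspace U ->
  (forall x, U x -> S x) -> finitely_spanned S -> S z -> ~ U z ->
  exists f : V -> F, [/\ linear_on S f, forall x, U x -> f x = 0 & f z <> 0].
Proof.
move=> sS sU US fS Sz nUz; have [k [b [Sb fb sb]]] := basis_mod sS sU US fS.
have sb' x : exists c : 'I_k -> F, S x -> U (x - \sum_i c i *: b i).
  have [/sb[c h]|nS] := pselect (S x); first by exists c.
  by exists (fun=> 0) => /nS.
have [c hc] := choice sb'.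
have cE x d : S x -> U (x - \sum_i d i *: b i) -> d =1 c x.
  move=> Sx Ud i; apply/eqP; rewrite -subr_eq0; apply/eqP.
  apply: (fb (fun i => d i - c x i)).
  under eq_bigr do rewrite scalerBl.
  rewrite sumrB; have := subspaceB sU (hc _ Sx) Ud.
  by rewrite opprB addrC addrA subrK.
have [i ci] : exists i, c z i <> 0.
  apply: contrapT => /forallNP h; apply: nUz.
  have := hc z Sz; rewrite big1 ?subr0 // => i _.
  by have /contrapT -> := h i; rewrite scale0r.
exists (fun x => c x i); split=> // [a x y Sx Sy|x Ux].
  rewrite -(cE _ (fun i => a * c x i + c y i)) //.
    by case: sS => _; apply.
  under eq_bigr do rewrite scalerDl -scalerA.
  rewrite big_split -scaler_sumr /= opprD addrACA -scalerBr.
  by case: sU => _; apply; apply: hc.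
rewrite -(cE x (fun=> 0)) //; first exact: US.
by rewrite big1 ?subr0 // => j _; rewrite scale0r.
Qed.

(** The coordinates of one basis in the other form a matrix with free rows. *)
Lemma has_dim_leq S k l : has_dim S k -> has_dim S l -> (k <= l)%N.
Proof.
move=> [b [Sb fb _]] [b' [_ _ sb']].
have /choice[A hA] i : exists c : 'I_l -> F, b i = \sum_j c j *: b' j.
  exact/sb'/Sb.
pose M : 'M[F]_(k, l) := \matrix_(i, j) A i j.
suff : row_free M by rewrite /row_free => /eqP <-; apply: rank_leq_col.
have Minj (u : 'rV_k) : u *m M = 0 -> u = 0.
  move=> /rowP uM; apply/rowP => i; rewrite mxE; apply: (fb (u 0)).
  under eq_bigr => i' _ do rewrite hA scaler_sumr.
  rewrite exchange_big big1 // => j _ /=.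
  under eq_bigr => i' _ do rewrite scalerA.
  rewrite -scaler_suml; have := uM j; rewrite !mxE.
  by under eq_bigr do rewrite mxE; move=> ->; rewrite scale0r.
rewrite -kermx_eq0; apply/eqP/row_matrixP => r; rewrite row0.
by apply: Minj; rewrite -row_mul mulmx_ker row0.
Qed.

Lemma has_dim_unique S k l : has_dim S k -> has_dim S l -> k = l.
Proof. by move=> hk hl; apply/eqP; rewrite eqn_leq !(has_dim_leq _ _ (S := S)). Qed.

Lemma has_dim_trivial S : (forall x, S x -> x = 0) -> has_dim S 0.
Proof.
move=> S0; exists (fun=> 0); split=> [[]//|? ? []//|x /S0 ->].
by exists (fun=> 0); rewrite big_ord0.
Qed.

Lemma has_dim_add S T k l : subspace S -> subspace T ->
  (forall x, S x -> T x -> x = 0) -> has_dim S k -> has_dim T l ->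
  has_dim (fun x => exists s t, [/\ S s, T t & x = s + t]) (k + l).
Proof.
move=> sS sT ST0 [b [Sb fb sb]] [b' [Tb' fb' sb']].
pose bb i := match fintype.split i with inl j => b j | inr j => b' j end.
have bbl j : bb (lshift l j) = b j.
  by rewrite /bb; case: splitP => j' /= /eqP; rewrite ?(inj_eq val_inj);
     [move/eqP->|rewrite ltn_eqF // ltn_addr].
have bbr j : bb (rshift k j) = b' j.
  rewrite /bb; case: splitP => j' /= /eqP.
    by rewrite gtn_eqF // ltn_addr.
  by rewrite eqn_add2l (inj_eq val_inj) => /eqP ->.
exists bb; split=> [i|c|v [s [t [/sb[c ->] /sb'[d ->] ->]]]].
- rewrite -(splitK i); case: (fintype.split i) => j /=; rewrite ?bbl ?bbr.
    by exists (b j), 0; split=> //; [apply: subspace0|rewrite addr0].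
  by exists 0, (b' j); split=> //; [apply: subspace0|rewrite add0r].
- rewrite big_split_ord /=; under eq_bigr do rewrite bbl.
  under [X in _ + X]eq_bigr do rewrite bbr.
  set s := \sum_(_ < _) _; set t := \sum_(_ < _) _ => st0.
  have s0 : s = 0.
    apply: ST0; first by apply: subspace_sum => // *; apply: subspaceZ.
    have -> : s = (-1) *: t by rewrite scaleN1r -[RHS]add0r -st0 addrK.
    by apply: subspaceZ => //; apply: subspace_sum => // *; apply: subspaceZ.
  move: st0; rewrite s0 add0r => t0 i.
  rewrite -(splitK i); case: (fintype.split i) => j /=.
    exact: (fb (fun j => c (lshift l j))).
  exact: (fb' (fun j => c (rshift k j))).
- exists (fun i => match fintype.split i with inl j => c j | inr j => d j end).
  rewrite big_split_ord /=; congr (_ + _); apply: eq_bigr => i _.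
    by rewrite bbl (unsplitK (inl i)).
  by rewrite bbr (unsplitK (inr i)).
Qed.

(** Dimensions add up in a direct sum. The index runs over a duplicate-free
    sequence so as to allow induction, and to cover sums over a part of P. *)
Lemma has_dim_bigsum (I : eqType) (r : seq I) (M : I -> V -> Prop) (k : I -> nat) :
  uniq r -> (forall i, subspace (M i)) -> (forall i, has_dim (M i) (k i)) ->
  (forall g : I -> V, (forall i, M i (g i)) -> \sum_(i <- r) g i = 0 ->
     forall i, i \in r -> g i = 0) ->
  has_dim (fun x => exists2 g : I -> V, forall i, M i (g i) & x = \sum_(i <- r) g i)
          (\sum_(i <- r) k i).
Proof.
move=> ur sM dM; elim: r ur => [|i r IH] /= ur hfree.
  by rewrite big_nil; apply: has_dim_trivial => x [g _]; rewrite big_nil.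
case/andP: ur => ir ur.
have {}IH : has_dim (fun x => exists2 g : I -> V, forall i, M i (g i) &
    x = \sum_(i <- r) g i) (\sum_(i <- r) k i).
  apply: IH => // g Mg g0 j jr.
  have := hfree (fun j => if j == i then 0 else g j).
  rewrite big_cons eqxx add0r => h.
  have {h} := h _ _ j; rewrite inE jr orbT; case: eqP => [ji|_].
    by rewrite -ji jr in ir.
  apply=> //; first by move=> j'; case: eqP => // _; apply: subspace0.
  rewrite -[RHS]g0 !big_seq; apply: eq_bigr => j' j'r; case: eqP => // ji.
  by rewrite -ji j'r in ir.
rewrite big_cons; have := has_dim_add _ _ _ (dM i) IH.
have upd (g : I -> V) x : \sum_(j <- r) (if j == i then x else g j) =
    \sum_(j <- r) g j.
  rewrite !big_seq; apply: eq_bigr => j' j'r; case: eqP => // ji.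
  by rewrite -ji j'r in ir.
move=> h; apply: has_dim_ext (h (sM i) _ _) => [x||x Mx [g Mg xE]].
- split=> [[s [_ [Ms [g Mg ->] ->]]]|[g Mg ->]].
    exists (fun j => if j == i then s else g j); last by rewrite big_cons eqxx upd.
    by move=> j; case: eqP => [->|].
  by rewrite big_cons; exists (g i), (\sum_(j <- r) g j); split=> //; exists g.
- split=> [|a _ _ [g Mg ->] [g' Mg' ->]].
    by exists (fun=> 0) => [j|]; [apply: subspace0|rewrite big1].
  exists (fun j => a *: g j + g' j); first by move=> j; case: (sM j) => _; apply.
  by rewrite big_split scaler_sumr.
- have := hfree (fun j => if j == i then x else - g j).
  rewrite big_cons eqxx upd sumrN -xE subrr => hf.
  have := hf _ _ i; rewrite mem_head eqxx; apply=> // j.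
  by case: eqP => [->//|_]; rewrite -scaleN1r; apply: subspaceZ.
Qed.

End Dimension.

Lemma has_dim_image (F : fieldType) (V W : lmodType F) (S : V -> Prop) k
    (f : V -> W) : linear f ->
  subspace S -> has_dim S k -> (forall x, S x -> f x = 0 -> x = 0) ->
  has_dim (fun y => exists2 x, S x & y = f x) k.
Proof.
move=> lf sS [b [Sb fb sb]] finj.
have fD x y : f (x + y) = f x + f y by rewrite -[x]scale1r lf !scale1r.
have f0 : f 0 = 0 by apply: (addrI (f 0)); rewrite -fD !addr0.
have fE (c : 'I_k -> F) : f (\sum_i c i *: b i) = \sum_i c i *: f (b i).
  rewrite (big_morph f fD f0); apply: eq_bigr => i _.
  by rewrite -[_ *: b i]addr0 lf f0 addr0.
exists (f \o b); split=> [i|c|y [x /sb[c ->] ->]].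
- by exists (b i).
- rewrite -fE => h; apply: fb; apply: finj h.
  by apply: subspace_sum => // i _; apply: subspaceZ.
- by exists c; rewrite fE.
Qed.

(** * Linear recurrences with noncommuting factors *)

Section Recurrences.
Variables (A : nzRingType) (E : Type) (x : E -> A).
Implicit Types (s u : nat -> A) (p : seq E) (e : E) (y : A).

Definition shift s : nat -> A := fun i => s i.+1.
(** The letter e acts on sequences as sigma - e, where e multiplies the values
    on the left; a word acts by the composite of the actions of its letters. *)
Definition step e s : nat -> A := fun i => s i.+1 - x e * s i.
Definition steps p s : nat -> A := foldr step s p.

Definition cons0 s : nat -> A := fun i => if i is j.+1 then s j else 0.
Definition unit_seq y : nat -> A := fun i => if i is 0%N then y else 0.

(** The right inverse of the action of e that gives sequences starting with 0. *)
Definition unstep e u : nat -> A :=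
  fix t i := if i is j.+1 then u j + x e * t j else 0.
Fixpoint unsteps p u : nat -> A :=
  if p is e :: p' then unsteps p' (unstep e u) else u.

(** The solution of the homogeneous equation of p with initial values
    0, ..., 0, y: since unsteps p (y, 0, 0, ...) starts with |p| zeros followed
    by y, shifting it once both puts y at the index |p| - 1 and kills its image
    (y, 0, 0, ...) under the action of p. For the empty word it is 0. *)
Definition fundamental p y : nat -> A := shift (unsteps p (unit_seq y)).

Lemma unstepS e u i : unstep e u i.+1 = u i + x e * unstep e u i.
Proof. by []. Qed.

Lemma unstepK e u : step e (unstep e u) = u.
Proof. by apply/funext => i; rewrite /step /= addrK. Qed.

Lemma unstepsK p u : steps p (unsteps p u) = u.
Proof. by elim: p u => //= e p IH u; rewrite IH unstepK. Qed.

Lemma stepK e s : s 0%N = 0 -> unstep e (step e s) = s.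
Proof.
by move=> s0; apply/funext; elim=> //= i ->; rewrite subrK.
Qed.

Lemma steps_shift p s : steps p (shift s) = shift (steps p s).
Proof. by elim: p => //= e p ->. Qed.

Lemma steps_head p s : (forall i, (i < size p)%N -> s i = 0) ->
  steps p s 0%N = s (size p).
Proof.
elim: p s => //= e p IH s s0.
rewrite {1}/step -[steps p s 1]/(shift (steps p s) 0%N) -steps_shift !IH.
- by rewrite (s0 (size p)) // mulr0 subr0.
- by move=> i lti; rewrite s0 // ltnW.
- by move=> i lti; apply: s0.
Qed.

Lemma stepsK p s : (forall i, (i < size p)%N -> s i = 0) ->
  unsteps p (steps p s) = s.
Proof.
elim: p => //= e p IH s0; rewrite stepK.
  by apply: IH => i lti; apply: s0; apply: ltnW.
by rewrite steps_head ?s0 // => i lti; apply: s0; apply: ltnW.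
Qed.

Lemma unsteps_cons0 p u : unsteps p (cons0 u) = cons0 (unsteps p u).
Proof.
elim: p u => //= e p IH u; rewrite -IH; congr unsteps.
apply/funext; elim=> // i IHi; rewrite unstepS {}IHi.
by case: i => [|i]; rewrite /= ?mulr0 ?addr0.
Qed.

Lemma unstepsD p u v : unsteps p (u + v) = unsteps p u + unsteps p v.
Proof.
elim: p u v => //= e p IH u v; rewrite -IH; congr unsteps.
apply/funext; elim=> [|i IHi]; first by rewrite -[RHS]/(0 + 0) addr0.
by rewrite -[RHS]/(_ + _) !unstepS IHi mulrDr addrACA.
Qed.

Lemma unsteps0 p : unsteps p 0 = 0.
Proof. by apply: (addrI (unsteps p 0)); rewrite -unstepsD !addr0. Qed.

(** A solution is determined by its |p| initial values. *)
Lemma steps_inj0 p s : steps p s = 0 ->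
  (forall i, (i < size p)%N -> s i = 0) -> s = 0.
Proof. by move=> Ds s0; rewrite -(stepsK s0) Ds unsteps0. Qed.

Lemma unsteps_lt p u i : (i < size p)%N -> unsteps p u i = 0.
Proof.
have : forall k, (forall j, (j < k)%N -> u j = 0) ->
    forall i, (i < k + size p)%N -> unsteps p u i = 0.
  elim: p u {i} => [|e p IH] u k u0 i; first by rewrite addn0; apply: u0.
  rewrite addnS -addSn; apply: IH => -[|j] //; rewrite ltnS.
  elim: j => [|j IHj] ltj /=; first by rewrite u0 // mulr0 addr0.
  rewrite (u0 _ ltj) add0r; move: IHj => /= -> //; first by rewrite mulr0.
  exact: ltnW.
by move=> /(_ 0%N (fun j (h : (j < 0)%N) => False_ind _ (notF h))); apply.
Qed.

Lemma unsteps_size p u : unsteps p u (size p) = u 0%N.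
Proof. by rewrite -(steps_head (@unsteps_lt p u)) unstepsK. Qed.

Lemma fundamental_lt p y i : (i.+1 < size p)%N -> fundamental p y i = 0.
Proof. exact: unsteps_lt. Qed.

Lemma fundamental_last p y i : i.+1 = size p -> fundamental p y i = y.
Proof. by move=> e; rewrite /fundamental /shift e unsteps_size. Qed.

Lemma steps_fundamental p y : steps p (fundamental p y) = 0.
Proof. by rewrite steps_shift unstepsK. Qed.

(** The sequence (y, e y, e ^ 2 y, ...) is annihilated by sigma - e. *)
Lemma fundamental_cons e p y :
  fundamental (e :: p) y = unsteps p (fun i => x e ^+ i * y).
Proof.
have -> : fundamental (e :: p) y = shift (unsteps p (cons0 (fun i => x e ^+ i * y))).
  rewrite /fundamental /=; congr (shift (unsteps _ _)); apply/funext.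
  elim=> // i IHi; rewrite unstepS {}IHi; case: i => [|i] /=.
    by rewrite mulr0 addr0 expr0 mul1r.
  by rewrite add0r exprS mulrA.
by rewrite unsteps_cons0.
Qed.

(** The identity that ties the fundamental solutions of neighbouring words to
    the multiplication of A: it comes from
    (y, e y, e ^ 2 y, ...) = (y, 0, 0, ...) + (0, e y, e ^ 2 y, ...). *)
Lemma fundamental_shift e p y :
  shift (fundamental (e :: p) y) =
  fundamental (e :: p) (x e * y) + fundamental p y.
Proof.
rewrite !fundamental_cons.
have -> : (fun i => x e ^+ i * y) =
    unit_seq y + cons0 (fun i => x e ^+ i * (x e * y)).
  apply/funext => -[|i]; rewrite -[RHS]/(_ + _) /= ?addr0 ?add0r.
    by rewrite expr0 mul1r.
  by rewrite exprSr mulrA.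
by rewrite unstepsD unsteps_cons0 addrC.
Qed.

Definition step_poly p : {poly A} := \prod_(e <- p) ('X - (x e)%:P).

(** The values of the sequence are multiplied on the left by the coefficients,
    which do not commute with each other; t becomes the shift. Hence the action
    of a word depends only on its polynomial. *)
Lemma stepsE p s i :
  steps p s i = \sum_(k < (size p).+1) (step_poly p)`_k * s (i + k)%N.
Proof.
elim: p i => [|e p IH] i.
  by rewrite big_ord1 /step_poly big_nil coef1 mul1r addn0.
rewrite /= {1}/step !IH /step_poly big_cons -/(step_poly p).
have sz : size (step_poly p) = (size p).+1 by rewrite size_prod_XsubC.
under [RHS]eq_bigr do rewrite mulrBl coefB coefXM coefCM mulrBl -mulrA.
rewrite sumrB; congr (_ - _).
  rewrite [RHS]big_ord_recl /= mul0r add0r; apply: eq_bigr => k _.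
  by rewrite /bump /= add1n addnS addSn.
rewrite -mulr_sumr; congr (_ * _).
by rewrite [RHS]big_ord_recr /= nth_default ?mul0r ?addr0 // sz.
Qed.

Lemma eq_steps p q s : size p = size q -> step_poly p = step_poly q ->
  steps p s = steps q s.
Proof. by move=> sz e; apply/funext => i; rewrite !stepsE sz e. Qed.

End Recurrences.

Arguments shift {A} s.

(** * Paths in ranked posets *)

Section RankedPosets.
Context (d : Order.disp_t) (P : finRankedPOrderType d).
Implicit Types (u v w : P) (e : edge P) (p q : seq (edge P)).

(** Take u between w and v with the largest number of elements below it. *)
Lemma exists_lower_cover w v : (w < v)%O -> exists2 u, covers u v & (w <= u)%O.
Proof.
move=> ltwv; pose Q u := (w <= u < v)%O.
have Qw : Q w by rewrite /Q lexx ltwv.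
case: (@arg_maxnP _ w Q (fun u => #|[pred x | (x <= u)%O]|) Qw).
move=> u /andP[lewu ltuv] umax; exists u => //; apply/andP; split=> //.
apply/forallP => r; apply/implyP => /andP[leur lerv].
have [->|nrv] := eqVneq r v; first by rewrite orbT.
rewrite orbF; apply: contraT => nru.
have /umax : Q r by rewrite /Q (le_trans lewu leur) lt_neqAle nrv.
rewrite /= leqNgt => /negP[]; apply: proper_card; apply/properP; split.
  by apply/subsetP => x; rewrite !inE => /le_trans; apply.
by exists r; rewrite !inE // lt_geF // lt_neqAle eq_sym nru.
Qed.

Lemma rank_lt w v : (w < v)%O -> (rank w < rank v)%N.
Proof.
have [n] := ubnP #|[pred x | (x < v)%O]|; elim: n => // n IH in v *.
rewrite ltnS => ltn ltwv; have [u cuv lewu] := exists_lower_cover ltwv.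
rewrite (rank_covers _ _ cuv) ltnS; have [->//|nwu] := eqVneq w u.
have {}ltwu : (w < u)%O by rewrite lt_neqAle nwu.
apply/ltnW/IH => //; apply: leq_trans ltn; apply: proper_card.
have /andP[ltuv _] := cuv; apply/properP; split.
  by apply/subsetP => x; rewrite !inE => /lt_trans; apply.
by exists u; rewrite !inE // ltxx.
Qed.

Lemma rank_le w v : (w <= v)%O -> (rank w <= rank v)%N.
Proof. by rewrite le_eqVlt => /orP[/eqP->//|/rank_lt/ltnW]. Qed.

Lemma unique_minimal_bottom : (exists! p : P, minimal p) ->
  exists2 b : P, rank b = 0%N & forall v, (b <= v)%O.
Proof.
move=> [b [bmin buniq]]; exists b => [|v]; first exact/rank_eq0.
case: (@arg_minnP _ v (fun u => (u <= v)%O) (@rank d P) (lexx v)) => m lemv mmin.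
suff /buniq -> : minimal m by [].
move=> q leqm; apply/eqP; apply: contraT => nqm.
have /rank_lt : (q < m)%O by rewrite lt_neqAle nqm.
by rewrite ltnNge mmin // (le_trans leqm).
Qed.

Lemma edge_rank e : rank (etail e) = (rank (ehead e)).+1.
Proof. exact: rank_covers _ _ (valP e). Qed.

Lemma edge_lt e : (ehead e < etail e)%O.
Proof. by have /andP[] := valP e. Qed.

Lemma covers_edge w v : covers w v -> exists2 e, etail e = v & ehead e = w.
Proof. by move=> cwv; exists (exist _ (v, w) cwv). Qed.

(** Contrary to [hasse_path] this allows the empty path, which is what
    inductions along paths start from. *)
Fixpoint is_path v p w : bool :=
  if p is e :: p' then (etail e == v) && is_path (ehead e) p' w else v == w.

Lemma is_path_rank v p w : is_path v p w -> rank v = (rank w + size p)%N.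
Proof.
elim: p v => [|e p IH] v /=; first by move/eqP ->; rewrite addn0.
by case/andP=> /eqP <- /IH; rewrite edge_rank addnS => ->.
Qed.

Lemma is_path_hasse v e p w : is_path v (e :: p) w <->
  [/\ etail e = v, hasse_path e p & ehead (last e p) = w].
Proof.
elim: p v e => [|e' p IH] v e /=.
  by split=> [/andP[/eqP-> /eqP]|[-> _ ->]] //; rewrite !eqxx.
have {}IH := IH (ehead e) e'; move: IH => /= IH; rewrite eq_sym in IH *.
split=> [/andP[/eqP -> /IH[e1 hp hl]]|[-> /andP[/eqP e1 hp] hl]].
  by split=> //; rewrite -e1 eqxx.
by rewrite eqxx /=; apply/IH.
Qed.

Lemma exists_path v w : (w <= v)%O -> exists p, is_path v p w.
Proof.
have [n] := ubnP (rank v); elim: n => // n IH in v * => ltn.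
rewrite le_eqVlt => /orP[/eqP ->|/exists_lower_cover[u cuv lewu]].
  by exists [::] => /=.
have [|p hp] := IH u _ lewu; first by rewrite -ltnS -(rank_covers _ _ cuv).
by have [e ev ew] := covers_edge cuv; exists (e :: p); rewrite /= ev ew eqxx.
Qed.

Definition max_rank := (\max_(v : P) rank v)%N.

Lemma rank_max v : (rank v <= max_rank)%N.
Proof. exact: leq_bigmax. Qed.

End RankedPosets.

(** * Solution spaces attached to the elements of a poset *)

Section GradedRecurrences.
Variables (F : fieldType) (A : algType F).
Context (d : Order.disp_t) (P : finRankedPOrderType d).
Variables (x : edge P -> A) (Ac : nat -> A -> Prop).
Hypothesis sAc : forall k, subspace (Ac k).
Hypothesis xAc : forall e k y, Ac k y -> Ac k.+1 (x e * y).
(* A chosen path from each element down to bot *)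
Variables (bot : P) (dp : P -> seq (edge P)).
Hypothesis bot_le : forall v : P, (bot <= v)%O.
Hypothesis dpP : forall v, is_path v (dp v) bot.
Hypothesis rank_bot : rank bot = 0%N.
Hypothesis pathA : forall v w p q, is_path v p w -> is_path v q w ->
  step_poly x p = step_poly x q.

Implicit Types (u v w : P) (e : edge P) (s : nat -> A) (y : A).

Lemma seqDE s t i : (s + t) i = s i + t i. Proof. by []. Qed.
Lemma seqBE s t i : (s - t) i = s i - t i. Proof. by []. Qed.
Lemma seqZE (a : F) s i : (a *: s) i = a *: s i. Proof. by []. Qed.

(** The grading translated by the largest rank, so that the negative degrees
    in which sequences of K_v may start become natural numbers. *)
Definition shifted_comp k y := if (k < max_rank P)%N then y = 0 else Ac (k - max_rank P) y.
Local Notation B := shifted_comp.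

Definition graded_seq n s := forall i, B (n + i) (s i).

(** The part of K_v of the sequences s with s_i of (translated) degree n + i. *)
Definition solutions v n s := graded_seq n s /\ steps x (dp v) s = 0.
Local Notation K := solutions.

Local Notation fund v := (fundamental x (dp v)).

Lemma size_dp v : size (dp v) = rank v.
Proof. by rewrite (is_path_rank (dpP v)) rank_bot. Qed.

Lemma steps_dp v p s : is_path v p bot -> steps x p s = steps x (dp v) s.
Proof.
move=> hp; apply: eq_steps; last exact: pathA (dpP v).
by apply: (@addnI (rank bot)); rewrite -(is_path_rank hp) -(is_path_rank (dpP v)).
Qed.

Lemma subspace_shifted k : subspace (B k).
Proof.
rewrite /subspace /shifted_comp; case: (k < max_rank P)%N.
  exact: subspace_eq0.
exact: sAc.
Qed.

Lemma shifted_mul e k y : B k y -> B k.+1 (x e * y).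
Proof.
rewrite /shifted_comp; case: ltnP => [ltk ->|lek hy]; last first.
  by rewrite ltnNge leqW //= subSn //; apply: xAc.
by rewrite mulr0; have [//|_] := boolP (_ < _)%N; apply: subspace0.
Qed.

Lemma shifted_lt k y : (k < max_rank P)%N -> B k y -> y = 0.
Proof. by rewrite /shifted_comp => ->. Qed.

Lemma step_linear e (a : F) s t : step x e (a *: s + t) = a *: step x e s + step x e t.
Proof.
apply/funext => i; rewrite /step -[LHS]/(a *: s i.+1 + t i.+1 - _ * (a *: s i + t i)).
by rewrite -[RHS]/(a *: (_ - _) + (_ - _)) mulrDr -scalerAr scalerBr opprD addrACA.
Qed.

Lemma steps_linear p (a : F) s t :
  steps x p (a *: s + t) = a *: steps x p s + steps x p t.
Proof. by elim: p => //= e p ->; rewrite step_linear. Qed.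

Lemma subspace_graded_seq n : subspace (graded_seq n).
Proof.
split=> [i|a s t hs ht i]; first exact: subspace0 (subspace_shifted _).
exact: (subspace_lin a (subspace_shifted (n + i)) (hs i) (ht i)).
Qed.

Lemma subspace_solutions v n : subspace (K v n).
Proof.
split=> [|a s t [gs es] [gt et]]; split.
- exact: subspace0 (subspace_graded_seq _).
- apply: (addrI (steps x (dp v) 0)).
  by have := steps_linear (dp v) 1 0 0; rewrite !scale1r !addr0.
- exact: subspace_lin (subspace_graded_seq n) gs gt.
- by rewrite steps_linear es et scaler0 addr0.
Qed.

Lemma solutions_shift v n j s : K v n s -> K v (n + j) (iter j shift s).
Proof.
move=> hs; elim: j => [|j [g e]]; first by rewrite addn0.
split=> [i|] /=; first by rewrite addnS addSnnS; apply: g.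
by rewrite steps_shift e.
Qed.

Lemma iter_shiftE j s i : iter j shift s i = s (j + i)%N.
Proof. by elim: j i => //= j IH i; rewrite /shift IH addSnnS. Qed.

Lemma graded_steps p n s : graded_seq n s -> graded_seq (n + size p) (steps x p s).
Proof.
move=> gs; elim: p => [|e p IH] /=; first by rewrite addn0.
move=> i; rewrite /step; apply: subspaceB; first exact: subspace_shifted.
  by rewrite addnS addSnnS; apply: IH.
by rewrite addnS addSn; apply: shifted_mul; apply: IH.
Qed.

Lemma graded_unsteps p n s : graded_seq (n + size p) s -> graded_seq n (unsteps x p s).
Proof.
elim: p s => [|e p IH] s /=; first by rewrite addn0.
rewrite addnS => gs; apply: IH; elim=> [|i IHi]; first exact: subspace0 (subspace_shifted _).
rewrite unstepS; apply: subspaceD; first exact: subspace_shifted.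
  by rewrite -addSnnS; apply: gs.
by rewrite addnS; apply: shifted_mul.
Qed.

Lemma solutions_inj0 v n s : K v n s -> (forall i, (i < rank v)%N -> s i = 0) -> s = 0.
Proof. by move=> [_ es] s0; apply: (steps_inj0 es) => i; rewrite size_dp => /s0. Qed.

Lemma solutions_bot n s : K bot n s -> s = 0.
Proof. by move=> hs; apply: (solutions_inj0 hs) => i; rewrite rank_bot. Qed.

(** Two solutions with the same initial values are equal. *)
Lemma fundamental_path v p y : is_path v p bot -> fundamental x p y = fund v y.
Proof.
move=> hp; apply/eqP; rewrite -subr_eq0; apply/eqP.
have sz : size p = rank v by rewrite (is_path_rank hp) rank_bot.
apply: (@steps_inj0 _ _ x (dp v)).
  have -> : fundamental x p y - fund v y = (-1) *: fund v y + fundamental x p y.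
    by rewrite scaleN1r addrC.
  by rewrite steps_linear steps_fundamental scaler0 add0r -(steps_dp _ hp) steps_fundamental.
move=> i; rewrite size_dp seqBE leq_eqVlt.
case/orP=> [/eqP e|lti]; first by rewrite !fundamental_last ?sz ?size_dp // subrr.
by rewrite !fundamental_lt ?sz ?size_dp // subrr.
Qed.

Lemma fund_edge e y : fund (etail e) y = fundamental x (e :: dp (ehead e)) y.
Proof. by apply/esym/fundamental_path; rewrite /= eqxx dpP. Qed.

Lemma fund_shift e y :
  shift (fund (etail e) y) = fund (etail e) (x e * y) + fund (ehead e) y.
Proof. by rewrite !fund_edge fundamental_shift. Qed.

Lemma fund_last v y i : i.+1 = rank v -> fund v y i = y.
Proof. by move=> h; rewrite fundamental_last // size_dp. Qed.

Lemma fund_lt v y i : (i.+1 < rank v)%N -> fund v y i = 0.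
Proof. by move=> h; rewrite fundamental_lt // size_dp. Qed.

(** The value of [fund_shift] at the index |w|, where w is the head of e. *)
Lemma edge_mulE e y :
  x e * y = fund (etail e) y (rank (etail e)) - fund (ehead e) y (rank (ehead e)).
Proof.
have /(congr1 (@^~ (rank (ehead e)))) := fund_shift e y.
rewrite /shift -edge_rank => ->.
by rewrite seqDE addrK fund_last // edge_rank.
Qed.

Lemma bot_edge v : v <> bot -> exists e, etail e = v.
Proof.
move=> nv; have [|u cuv _] := @exists_lower_cover _ _ bot v.
  by rewrite lt_neqAle bot_le andbT eq_sym; apply/eqP.
by have [e ev _] := covers_edge cuv; exists e.
Qed.

Lemma fund_bot y : fund bot y = 0.
Proof.
have := size_dp bot; rewrite rank_bot => /size0nil ->.
by apply/funext.
Qed.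

Lemma solutions_fund v N y : (rank v <= N.+1)%N -> B N y -> K v (N.+1 - rank v) (fund v y).
Proof.
have [->|/bot_edge[e <-]] := pselect (v = bot).
  by rewrite fund_bot => *; exact: subspace0 (subspace_solutions _ _).
rewrite edge_rank ltnS subSS => len hy; split; last exact: steps_fundamental.
rewrite fund_edge fundamental_cons; apply: graded_unsteps.
rewrite size_dp subnK //; elim=> [|i IHi]; first by rewrite addn0 mul1r.
by rewrite addnS exprS -mulrA; apply: shifted_mul.
Qed.

Lemma solutions_edge e n s : K (ehead e) n s -> K (etail e) n s.
Proof.
move=> [gs es]; split=> //.
rewrite -(@steps_dp _ (e :: dp (ehead e))) /= ?eqxx ?dpP // es.
by apply/funext => i; rewrite /step mulr0 subr0.
Qed.

Lemma solutions_mono w v n s : (w <= v)%O -> K w n s -> K v n s.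
Proof.
have [m] := ubnP (rank v); elim: m => // m IH in v * => ltm.
rewrite le_eqVlt => /orP[/eqP ->//|/exists_lower_cover[u cuv lewu] hs].
have [e ev eu] := covers_edge cuv.
have {}IH := IH u _ lewu hs; rewrite -ev; apply: solutions_edge; rewrite eu; apply: IH.
by rewrite -ltnS -(rank_covers _ _ cuv).
Qed.

(** If v covers w along e, then s in K_v is mapped by P_w(sigma) to a sequence
    u killed by sigma - e, that is (y, e y, e ^ 2 y, ...), which is also the
    image of fund_v(y). *)
Lemma solutions_split e n s : K (etail e) n s ->
  exists t y, [/\ K (ehead e) n t, B (n + rank (ehead e)) y &
    s = t + fund (etail e) y].
Proof.
move=> [gs es]; set w := ehead e; set u := steps x (dp w) s.
have eu : step x e u = 0.
  by rewrite -[LHS]/(steps x (e :: dp w) s) (@steps_dp (etail e)) //= eqxx dpP.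
have gu : graded_seq (n + rank w) u by rewrite -size_dp; apply: graded_steps.
have uE : fund (etail e) (u 0%N) = unsteps x (dp w) u.
  rewrite fund_edge fundamental_cons; congr unsteps; apply/funext; elim=> [|i IHi].
    by rewrite mul1r.
  rewrite exprS -mulrA IHi; apply/esym/eqP; rewrite -subr_eq0; apply/eqP.
  by have /(congr1 (@^~ i)) := eu.
exists (s - fund (etail e) (u 0%N)), (u 0%N); split; last by rewrite subrK.
- rewrite uE; split.
    apply: (subspaceB (subspace_graded_seq n)) => //.
    by apply: graded_unsteps; rewrite size_dp.
  have -> : s - unsteps x (dp w) u = (-1) *: unsteps x (dp w) u + s.
    by rewrite scaleN1r addrC.
  by rewrite steps_linear unstepsK scaleN1r addNr.
- by have := gu 0%N; rewrite addn0.
Qed.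

Lemma fund_linear v (a : F) y z : fund v (a *: y + z) = a *: fund v y + fund v z.
Proof.
apply/eqP; rewrite -subr_eq0; apply/eqP.
set r := _ + fund v z; apply: (@steps_inj0 _ _ x (dp v)).
  have -> : fund v (a *: y + z) - r = (-1) *: r + fund v (a *: y + z).
    by rewrite scaleN1r addrC.
  by rewrite /r !steps_linear !steps_fundamental !scaler0 !addr0 scaler0.
move=> i; rewrite size_dp seqBE leq_eqVlt.
rewrite /r seqDE seqZE.
case/orP=> [/eqP e|lti]; first by rewrite !fund_last // subrr.
by rewrite !fund_lt // scaler0 addr0 subrr.
Qed.

(** Each of the |v| initial values ranges over a graded component of A. *)
Lemma solutions_dim (h : nat -> nat) : (forall k, has_dim (B k) (h k)) ->
  forall v n, has_dim (K v n) (\sum_(i < rank v) h (n + i)%N).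
Proof.
move=> hB v n; have [m] := ubnP (rank v); elim: m => // m IH in v * => ltm.
have [->|/bot_edge[e ev]] := pselect (v = bot).
  by rewrite rank_bot big_ord0; apply: has_dim_trivial => s /solutions_bot.
move: ltm; rewrite -{v}ev edge_rank ltnS big_ord_recr /= => ltm.
set w := ehead e in ltm *; have gK := solutions_split (e := e).
have hi : has_dim (fun s => exists2 y, B (n + rank w) y & s = fund (etail e) y)
    (h (n + rank w)%N).
  apply: has_dim_image; [exact: fund_linear|exact: subspace_shifted|exact: hB|].
  by move=> y _ /(congr1 (@^~ (rank w))); rewrite fund_last ?edge_rank.
have Ki y : B (n + rank w) y -> K (etail e) n (fund (etail e) y).
  move=> hy; have le : (rank (etail e) <= (n + rank w).+1)%N.
    by rewrite edge_rank ltnS leq_addl.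
  by have := solutions_fund le hy; rewrite edge_rank subSS addnK.
apply: (has_dim_ext _ (has_dim_add (subspace_solutions w n) _ _ (IH w ltm) hi)) => [s||s].
- split=> [[t [_ [ht [y hy ->] ->]]]|/gK[t [y [ht hy ->]]]].
    by apply: subspaceD; [apply: subspace_solutions|apply: solutions_edge|apply: Ki].
  by exists t, (fund (etail e) y); split=> //; exists y.
- split=> [|a _ _ [y hy ->] [z hz ->]].
    exists 0; first exact: subspace0 (subspace_shifted _).
    by have := fund_linear (etail e) (-1) 0 0; rewrite scaler0 addr0 scaleN1r addNr.
  exists (a *: y + z); last by rewrite fund_linear.
  exact: subspace_lin (subspace_shifted _) hy hz.
- move=> hs [y hy sE]; apply: (solutions_inj0 hs) => i lti.
  by rewrite sE fund_lt // edge_rank ltnS.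
Qed.

(** The sum of the K_w for w < v, in a given degree. *)
Definition lower_solutions v n s : Prop :=
  exists2 g : P -> nat -> A, forall w, K w n (g w) & s = \sum_(w | (w < v)%O) g w.
Local Notation Klow := lower_solutions.

Lemma subspace_lower v n : subspace (Klow v n).
Proof.
split=> [|a _ _ [g gK ->] [h hK ->]].
  exists (fun=> 0); last by rewrite big1.
  by move=> w; apply: subspace0 (subspace_solutions w n).
exists (fun w => a *: g w + h w); last by rewrite big_split scaler_sumr.
by move=> w; apply: subspace_lin (subspace_solutions w n) (gK w) (hK w).
Qed.

Lemma lower_solutionsW v n s : Klow v n s -> K v n s.
Proof.
move=> [g gK ->]; apply: subspace_sum; first exact: subspace_solutions.
by move=> w /ltW lewv; apply: solutions_mono (gK w).
Qed.

Lemma solutions_lower w v n s : (w < v)%O -> K w n s -> Klow v n s.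
Proof.
move=> ltwv hs; exists (fun u => if u == w then s else 0).
  by move=> u; case: eqP => [->//|_]; apply: subspace0 (subspace_solutions u n).
rewrite (bigD1 w) //= eqxx big1 ?addr0 // => u /andP[_ /negbTE ->] //.
Qed.

Hypothesis genAc : forall k y, Ac k.+1 y ->
  exists2 g : edge P -> A, forall e, Ac k (g e) & y = \sum_e x e * g e.
(* Compatible functionals on the K_v come from a functional on A. Degrees are
   such that the values s_|v| for s in K_v (N - |v|) lie in B N, and N exceeds
   the translation, that is, these values have positive degree in A. *)
Hypothesis extension : forall N (f : P -> (nat -> A) -> F), (max_rank P < N)%N ->
  (forall v, linear_on (K v (N - rank v)) (f v)) ->
  (forall e s, K (ehead e) (N - rank (etail e)) s ->
     f (etail e) s = f (ehead e) (shift s)) ->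
  exists2 fb : A -> F, linear_on (B N) fb & forall e y, B N.-1 y ->
    fb (x e * y) = f (etail e) (fund (etail e) y) - f (ehead e) (fund (ehead e) y).

(* Chosen complements of the lower solutions *)
Variables (M : P -> nat -> (nat -> A) -> Prop) (km : P -> nat -> nat).
Hypothesis sM : forall v n, subspace (M v n).
Hypothesis MK : forall v n s, M v n s -> K v n s.
Hypothesis dimM : forall v n, has_dim (M v n) (km v n).
Hypothesis M_split : forall v n s, K v n s ->
  exists s1 s2, [/\ Klow v n s1, M v n s2 & s = s1 + s2].
Hypothesis M_lower : forall v n s, Klow v n s -> M v n s -> s = 0.

Lemma solutions_spanned v n (h : nat -> nat) : (forall k, has_dim (B k) (h k)) ->
  finitely_spanned (K v n).
Proof. by move=> hB; apply: has_dim_spanned (solutions_dim hB v n). Qed.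

Lemma solutions_decomp v n s : K v n s ->
  exists g : P -> nat -> A, [/\ forall w, M w n (g w),
    forall w, ~~ (w <= v)%O -> g w = 0 & s = \sum_w g w].
Proof.
have [m] := ubnP (rank v); elim: m => // m IH in v s * => ltm hs.
have [_ [t [[g gK ->] ht ->]]] := M_split hs.
have /choice[G hG] w : exists G : P -> nat -> A, (w < v)%O ->
    [/\ forall z, M z n (G z), forall z, ~~ (z <= w)%O -> G z = 0 &
      g w = \sum_z G z].
  have [ltwv|] := boolP (w < v)%O; last by exists (fun=> 0).
  have [|G hG] := IH w (g w) _ (gK w); last by exists G.
  by apply: leq_trans (rank_lt ltwv) _; rewrite -ltnS.
exists (fun z => \sum_(w | (w < v)%O) G w z + (if z == v then t else 0)); split.
- move=> z; apply: subspaceD => //.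
    by apply: subspace_sum => // w /hG[].
  by case: eqP => [->|_] //; apply: subspace0.
- move=> z nz; rewrite (_ : z == v = false) ?addr0; last first.
    by apply: contraNF nz => /eqP ->.
  rewrite big1 // => w ltwv; have [_ + _] := hG w ltwv; apply.
  by apply: contra nz => /le_trans; apply; apply: ltW.
- rewrite big_split /= -big_mkcond big_pred1_eq exchange_big /=.
  by congr (_ + _); apply: eq_bigr => w /hG[].
Qed.

(** The sum of the complements in degree n is direct. As K_v is the sum of the
    M_w for w <= v, this says that the K_v are in general position. *)
Definition independent n : Prop := forall g : P -> nat -> A,
  (forall w, M w n (g w)) -> \sum_w g w = 0 -> forall w, g w = 0.

Lemma independent_uniq n (g h : P -> nat -> A) : independent n ->
  (forall w, M w n (g w)) -> (forall w, M w n (h w)) ->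
  \sum_w g w = \sum_w h w -> g = h.
Proof.
move=> Dn gM hM e; apply/funext => w; apply/eqP; rewrite -subr_eq0; apply/eqP.
apply: (Dn (fun w => g w - h w)) => [z|]; first exact: subspaceB.
by rewrite sumrB e subrr.
Qed.

Lemma iter_shift_linear j (a : F) s t :
  iter j shift (a *: s + t) = a *: iter j shift s + iter j shift t.
Proof. by elim: j => //= j ->. Qed.

Lemma iter_shift0 j : iter j shift (0 : nat -> A) = 0.
Proof. by apply/funext => i; rewrite iter_shiftE. Qed.

Lemma iter_shiftD j s t : iter j shift (s + t) = iter j shift s + iter j shift t.
Proof. by have := iter_shift_linear j 1 s t; rewrite !scale1r. Qed.

Lemma iter_shiftB j s t : iter j shift (s - t) = iter j shift s - iter j shift t.
Proof. by apply: (addIr (iter j shift t)); rewrite -iter_shiftD !subrK. Qed.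

Lemma fundD v y z : fund v (y + z) = fund v y + fund v z.
Proof. by have := fund_linear v 1 y z; rewrite !scale1r. Qed.

Lemma fundB v y z : fund v (y - z) = fund v y - fund v z.
Proof. by apply: (addIr (fund v z)); rewrite -fundD !subrK. Qed.

Lemma fund0 v : fund v 0 = 0.
Proof. by rewrite -(subrr (0 : A)) fundB subrr. Qed.

Lemma fundZ v (a : F) y : fund v (a *: y) = a *: fund v y.
Proof. by have := fund_linear v a y 0; rewrite fund0 !addr0. Qed.

Lemma iter_fund_shift j e y : iter j.+1 shift (fund (etail e) y) =
  iter j shift (fund (etail e) (x e * y)) + iter j shift (fund (ehead e) y).
Proof. by rewrite iterSr fund_shift iter_shiftD. Qed.

Lemma iter_shift_sum j (I : finType) (g : I -> nat -> A) :
  iter j shift (\sum_i g i) = \sum_i iter j shift (g i).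
Proof.
by apply: (big_morph (iter j shift)) => [s t|]; [apply: iter_shiftD|apply: iter_shift0].
Qed.

Lemma solutions_shift_down z v w N s : (w <= v)%O -> (max_rank P < N)%N ->
  K z (N - rank v) s -> K z (N - rank w) (iter (rank v - rank w) shift s).
Proof.
move=> /rank_le lewv ltN hs; have := solutions_shift (rank v - rank w) hs.
by rewrite addnBA // subnK // ltnW // (leq_ltn_trans (rank_max v)).
Qed.

(** A functional phi on K_u that vanishes on the lower K_w belongs to a
    compatible family, which is 0 at the other elements of rank at most |u|.
    Above this rank the functional at v is forced on the sum of the K_w, w < v,
    and may be taken to be 0 on M_v; that it is well defined is the
    independence of the M_w in the degree where it lives. *)
Lemma glue_functionals N u (phi : (nat -> A) -> F) : (max_rank P < N)%N ->
  linear_on (K u (N - rank u)) phi ->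
  (forall s, Klow u (N - rank u) s -> phi s = 0) ->
  (forall v, (rank u < rank v)%N -> independent (N - rank v)) ->
  exists f : P -> (nat -> A) -> F,
    [/\ f u = phi, forall v, (rank v <= rank u)%N -> v <> u -> f v = fun=> 0,
      forall v, linear_on (K v (N - rank v)) (f v) &
      forall v w s, (w < v)%O -> K w (N - rank v) s ->
        f v s = f w (iter (rank v - rank w) shift s)].
Proof.
move=> ltN lphi phi0 Dh.
suff /(_ (max_rank P)) [f [fu f0 fl fc]] : forall r, exists f : P -> (nat -> A) -> F,
    [/\ f u = phi, forall v, (rank v <= rank u)%N -> v <> u -> f v = fun=> 0,
      forall v, (rank v <= maxn r (rank u))%N -> linear_on (K v (N - rank v)) (f v) &
      forall v w s, (rank v <= maxn r (rank u))%N -> (w < v)%O ->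
        K w (N - rank v) s -> f v s = f w (iter (rank v - rank w) shift s)].
  exists f; split=> // [v|v w s].
    by apply: fl; rewrite leq_max rank_max.
  by apply: fc; rewrite leq_max rank_max.
elim=> [|r [f [fu f0 fl fc]]].
  exists (fun v => if v == u then phi else fun=> 0); rewrite max0n; split.
  - by rewrite eqxx.
  - by move=> v _ /eqP/negbTE ->.
  - move=> v _; case: eqP => [->//|_] a s t _ _.
    by rewrite mulr0 addr0.
  - move=> v w s levu ltwv hs; have ltwu := leq_trans (rank_lt ltwv) levu.
    rewrite (_ : w == u = false); last by apply: contraTF ltwu => /eqP ->; rewrite ltnn.
    by case: eqP => // vu; apply: phi0; rewrite -vu; apply: solutions_lower hs.
have [ler|ltr] := leqP r.+1 (rank u).
  by rewrite (maxn_idPr (ltnW ler)) in fl fc; exists f.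
rewrite ltnS in ltr; rewrite (maxn_idPl ltr) in fl fc.
have /choice[dec hdec] (vs : P * (nat -> A)) : exists g : P -> nat -> A,
    K vs.1 (N - rank vs.1) vs.2 -> [/\ forall w, M w (N - rank vs.1) (g w),
    forall w, ~~ (w <= vs.1)%O -> g w = 0 & vs.2 = \sum_w g w].
  have [/solutions_decomp[g hg]|] := pselect (K vs.1 (N - rank vs.1) vs.2).
    by exists g.
  by exists (fun=> 0).
(* Decompose s into its components in the M_w, and use the functionals at w < v. *)
pose f' v s := if (rank v <= r)%N then f v s else
  \sum_(w | (w < v)%O) f w (iter (rank v - rank w) shift (dec (v, s) w)).
have f'E v : (rank v <= r)%N -> f' v = f v by rewrite /f' => ->.
have decK v s w : K v (N - rank v) s -> (w < v)%O ->
    K w (N - rank w) (iter (rank v - rank w) shift (dec (v, s) w)).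
  move=> hs ltwv; apply: solutions_shift_down ltN _; first exact: ltW.
  by have [hM _ _] := hdec (v, s) hs; apply: MK.
have lt_r v w : (rank v <= r.+1)%N -> (w < v)%O -> (rank w <= r)%N.
  by move=> lev ltwv; rewrite -ltnS (leq_trans (rank_lt ltwv)).
exists f'; split.
- by rewrite f'E.
- by move=> v lev nvu; rewrite f'E ?f0 // (leq_trans lev).
- move=> v lev; have [ler|ltrv] := leqP (rank v) r; first by rewrite f'E //; apply: fl.
  move=> a s t hs ht; rewrite /f' leqNgt ltrv /=.
  have hst := subspace_lin a (subspace_solutions _ _) hs ht.
  have -> : dec (v, a *: s + t) = fun w => a *: dec (v, s) w + dec (v, t) w.
    have [sM1 _ /= e1] := hdec (v, _) hst; have [sM2 _ /= e2] := hdec (v, s) hs.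
    have [sM3 _ /= e3] := hdec (v, t) ht.
    apply: (@independent_uniq (N - rank v)) => //.
    - by apply: Dh; apply: leq_ltn_trans ltrv.
    - by move=> w; apply: subspace_lin.
    - by rewrite -e1 big_split -scaler_sumr /= -e2 -e3.
  rewrite mulr_sumr -big_split; apply: eq_bigr => w ltwv /=.
  rewrite iter_shift_linear (fl w) //; [exact: lt_r ltwv|exact: decK|exact: decK].
- move=> v w s lev ltwv hs; rewrite (f'E w) ?(lt_r v) //.
  have [ler|ltrv] := leqP (rank v) r; first by rewrite f'E //; apply: fc.
  rewrite /f' leqNgt ltrv /=.
  have hsv := solutions_mono (ltW ltwv) hs.
  have [g [gM g0 sE]] := solutions_decomp hs.
  have -> : dec (v, s) = g.
    have [sM1 _ /= e1] := hdec (v, s) hsv.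
    apply: (@independent_uniq (N - rank v)) => //; last by rewrite -e1.
    by apply: Dh; apply: leq_ltn_trans ltrv.
  have lewv := rank_le (ltW ltwv).
  have f0' z : (rank z <= r)%N -> f z 0 = 0.
    by move=> lez; apply: linear_on0 (subspace_solutions _ _) (fl z lez).
  have gKw z : K w (N - rank w) (iter (rank v - rank w) shift (g z)).
    have [lezw|/g0 ->] := boolP (z <= w)%O; last first.
      by rewrite iter_shift0; apply: subspace0 (subspace_solutions _ _).
    by apply: solutions_shift_down (ltW ltwv) ltN _; apply: (solutions_mono lezw); apply: MK.
  (* Both sides are computed from the components of s, which lie below w. *)
  rewrite sE iter_shift_sum (linear_on_sum _ (subspace_solutions _ _) (fl w (lt_r _ _ lev ltwv))) //.
  rewrite big_mkcond; apply: eq_bigr => z _.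
  have [lezw|nzw] := boolP (z <= w)%O; last first.
    rewrite (g0 z nzw) !iter_shift0 (f0' w) ?(lt_r v) //.
    by case: ifP => // ltzv; rewrite f0' // (lt_r v).
  rewrite (le_lt_trans lezw ltwv); move: lezw; rewrite le_eqVlt => /orP[/eqP -> //|ltzw].
  have lezw := rank_le (ltW ltzw).
  rewrite (fc w z) ?(lt_r v) //; last first.
    apply: solutions_shift_down ltN _; first exact: ltW.
    exact: MK.
  by rewrite -iterD addnC addnBA // subnK.
Qed.

Hypothesis finB : exists h : nat -> nat, forall k, has_dim (B k) (h k).

(** By induction on v: if v covers w along e, then K_v is the sum of K_w, where
    the claim follows from compatibility, and of the fund_v(y), where it follows
    from [edge_mulE] and the claim for w. *)
Lemma extension_eval N (f : P -> (nat -> A) -> F) (fb : A -> F) :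
  (max_rank P < N)%N ->
  (forall v, linear_on (K v (N - rank v)) (f v)) ->
  (forall e s, K (ehead e) (N - rank (etail e)) s ->
     f (etail e) s = f (ehead e) (shift s)) ->
  linear_on (B N) fb ->
  (forall e y, B N.-1 y ->
    fb (x e * y) = f (etail e) (fund (etail e) y) - f (ehead e) (fund (ehead e) y)) ->
  forall v s, K v (N - rank v) s -> fb (s (rank v)) = f v s.
Proof.
move=> ltN lf cf lfb fbE v s; have NE : N = N.-1.+1 by rewrite (ltn_predK ltN).
have leN w : (rank w <= N)%N by apply: leq_trans (rank_max w) (ltnW ltN).
have [m] := ubnP (rank v); elim: m => // m IH in v s * => ltm hs.
have Bs w r : K w (N - rank w) r -> B N (r (rank w)).
  by move=> [gr _]; have := gr (rank w); rewrite subnK.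
have [vb|/bot_edge[e ev]] := pselect (v = bot).
  have s0 : s = 0 by move: hs; rewrite vb; apply: solutions_bot.
  rewrite s0 (linear_on0 (subspace_solutions _ _) (lf v)).
  exact: linear_on0 (subspace_shifted N) lfb.
move: ltm hs; rewrite -{v}ev => ltm hs.
have ltm' : (rank (ehead e) < m)%N by rewrite -ltnS -edge_rank.
have [t [y [ht hy sE]]] := solutions_split hs.
have {}hy : B N.-1 y.
  have <- : (N - rank (etail e) + rank (ehead e) = N.-1)%N; last exact: hy.
  by have := leN (etail e); rewrite edge_rank; case: (N) => // n le; rewrite subSS subnK.
have lew : (ehead e <= etail e)%O by apply/ltW/edge_lt.
have rE : (rank (etail e) - rank (ehead e) = 1)%N by rewrite edge_rank subSnn.
have Kt : K (etail e) (N - rank (etail e)) t by apply: solutions_mono ht.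
have Ki w : K w (N - rank w) (fund w y).
  by have := @solutions_fund w N.-1 y; rewrite -NE; apply.
have Kst : K (ehead e) (N - rank (ehead e)) (shift t).
  by have := solutions_shift_down lew ltN ht; rewrite rE.
rewrite sE seqDE (linear_onD lfb (Bs _ _ Kt) (Bs _ _ (Ki _))).
rewrite (linear_onD (lf _) Kt (Ki _)); congr (_ + _).
  by rewrite (cf _ _ ht) -IH // /shift -edge_rank.
have := fbE e y hy; rewrite edge_mulE.
rewrite (linear_onB lfb (Bs _ _ (Ki _)) (Bs _ _ (Ki _))) (IH (ehead e)) //.
by move/addIr.
Qed.

(** In a relation between the values s_|v| the terms of highest rank lie in the
    lower solutions: otherwise a functional separates one of them, and the
    functional on A obtained from it contradicts the relation. *)
Lemma top_component_lower N u (z : P -> nat -> A) : (max_rank P < N)%N ->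
  (forall v, (rank u < rank v)%N -> independent (N - rank v)) ->
  (forall v, K v (N - rank v) (z v)) ->
  (forall v, (rank u < rank v)%N -> z v = 0) ->
  \sum_v z v (rank v) = 0 ->
  Klow u (N - rank u) (z u).
Proof.
move=> ltN Dh zK z0 sum0; apply: contrapT => nlow.
have [h hB] := finB.
have [phi [lphi phi0 phiz]] := separating_functional (subspace_solutions _ _)
  (subspace_lower _ _) (@lower_solutionsW _ _) (solutions_spanned _ _ hB) (zK u) nlow.
have [f [fu f0 fl fc]] := glue_functionals ltN lphi phi0 Dh.
have ce e s : K (ehead e) (N - rank (etail e)) s ->
    f (etail e) s = f (ehead e) (shift s).
  by move=> hs; rewrite (fc _ _ _ (edge_lt e) hs) edge_rank subSnn.
have [fb lfb fbE] := extension ltN fl ce.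
have ev := extension_eval ltN fl ce lfb fbE.
have leN w : (rank w <= N)%N by apply: leq_trans (rank_max w) (ltnW ltN).
apply: phiz; have := linear_on0 (subspace_shifted N) lfb; rewrite -sum0.
rewrite (linear_on_sum _ (subspace_shifted N) lfb); last first.
  by move=> v _; have [gz _] := zK v; have := gz (rank v); rewrite subnK.
rewrite (bigD1 u) //= big1 ?addr0 => [|v nvu]; first by rewrite ev // fu.
rewrite ev //; have [lev|ltv] := leqP (rank v) (rank u).
  by rewrite f0 //; apply/eqP.
by rewrite z0 // (linear_on0 (subspace_solutions _ _) (fl v)).
Qed.

Lemma exists_top_nonzero (g : P -> nat -> A) : ~ (forall w, g w = 0) ->
  exists2 u, g u <> 0 & forall v, (rank u < rank v)%N -> g v = 0.
Proof.
move=> /existsNP[w /eqP gw].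
case: (@arg_maxnP _ w (fun v => g v != 0) (@rank d P) gw) => u /eqP gu umax.
exists u => // v ltuv; apply/eqP; apply: contraTT ltuv => /umax /=.
by rewrite -leqNgt.
Qed.

(** Strong induction on n: the relation, evaluated at the largest rank that
    occurs in it, is one to which [top_component_lower] applies. *)
Lemma independentP n : independent n.
Proof.
have [m] := ubnP n; elim: m => // m IH in n *; rewrite ltnS => ltm.
move=> g gM g0; apply: contrapT => /exists_top_nonzero[u gu gtop]; apply: gu.
(* In low degrees the initial values vanish for reasons of degree. *)
have [leN|ltN] := leqP (n + rank u) (max_rank P).
  apply: (solutions_inj0 (MK (gM u))) => i lti; have [gr _] := MK (gM u).
  by apply: shifted_lt (gr i); apply: leq_trans leN; rewrite ltn_add2l.
apply: M_lower (gM u).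
pose z v := if (rank v <= rank u)%N then iter (rank u - rank v) shift (g v) else 0.
have -> : g u = z u by rewrite /z leqnn subnn.
rewrite -[n](addnK (rank u)); apply: top_component_lower => //.
- move=> v ltv; apply: IH; apply: leq_trans ltm.
  rewrite ltn_subLR; first by rewrite addnC ltn_add2r.
  by apply: leq_trans (rank_max v) (ltnW ltN).
- move=> v; rewrite /z; case: leqP => [lev|_]; last exact: subspace0 (subspace_solutions _ _).
  by rewrite -addnBA //; apply/solutions_shift/MK.
- by move=> v ltv; rewrite /z leqNgt ltv.
- rewrite -[RHS]/((0 : nat -> A) (rank u)) -g0 fct_sumE; apply: eq_bigr => v _.
  rewrite /z; case: leqP => [lev|/gtop -> //]; by rewrite iter_shiftE subnK.
Qed.

Lemma top_values_independent N (g : P -> nat -> A) : (max_rank P < N)%N ->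
  (forall w, M w (N - rank w) (g w)) -> \sum_w g w (rank w) = 0 ->
  forall w, g w = 0.
Proof.
move=> ltN gM g0; apply: contrapT => /exists_top_nonzero[u gu gtop]; apply: gu.
apply: M_lower (gM u); apply: top_component_lower => // v *; first exact: independentP.
exact: MK.
Qed.

(** The part of degree N of A that comes from M_v. *)
Definition top_values N v y : Prop := exists2 s, M v (N - rank v) s & y = s (rank v).

Lemma top_values_dim N v : (max_rank P < N)%N ->
  has_dim (top_values N v) (km v (N - rank v)).
Proof.
move=> ltN; apply: (@has_dim_image _ _ _ _ _ (fun s => s (rank v))) => //.
move=> s hs s0; have := @top_values_independent N (fun w => if w == v then s else 0) ltN.
move=> /(_ _ _ v); rewrite eqxx; apply.
  by move=> w; case: eqP => [->|_] //; apply: subspace0.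
rewrite (bigD1 v) //= eqxx s0 big1 ?addr0 // => w /negbTE -> //.
Qed.

Lemma subspace_top_values N v : subspace (top_values N v).
Proof.
split=> [|a _ _ [s hs ->] [t ht ->]].
  by exists 0 => //; apply: subspace0.
by exists (a *: s + t) => //; apply: subspace_lin.
Qed.

Lemma shifted_top_values N y : (max_rank P < N)%N -> B N y <->
  exists2 g : P -> A, forall v, top_values N v (g v) & y = \sum_v g v.
Proof.
move=> ltN; have leN w : (rank w <= N)%N by apply: leq_trans (rank_max w) (ltnW ltN).
pose S y := exists2 g : P -> A, forall v, top_values N v (g v) & y = \sum_v g v.
have sS : subspace S.
  split=> [|a _ _ [g hg ->] [g' hg' ->]].
    by exists (fun=> 0); [move=> v; apply: subspace0 (subspace_top_values N v)|rewrite big1].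
  exists (fun w => a *: g w + g' w); last by rewrite big_split scaler_sumr.
  by move=> w; apply: subspace_lin (subspace_top_values N w) (hg w) (hg' w).
have KS v s : K v (N - rank v) s -> S (s (rank v)).
  have [m] := ubnP (rank v); elim: m => // m IH in v s * => ltm.
  move=> /M_split[_ [t [[g gK ->] ht ->]]]; rewrite seqDE fct_sumE.
  apply: subspaceD => //; last first.
    exists (fun w => if w == v then t (rank v) else 0); last by rewrite -big_mkcond big_pred1_eq.
    move=> w; case: eqP => [->|_]; first by exists t.
    exact: subspace0 (subspace_top_values N w).
  apply: subspace_sum => // w ltwv; have ltr := rank_lt ltwv.
  have := IH w _ _ (solutions_shift_down (ltW ltwv) ltN (gK w)).
  rewrite iter_shiftE subnK ?(ltnW ltr) //; apply.
  exact: leq_trans ltr _.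
split=> [|[g hg ->]]; last first.
  apply: subspace_sum => [|v _]; first exact: subspace_shifted.
  have [s /MK[gs _] ->] := hg v; by have := gs (rank v); rewrite subnK.
have NE : N = N.-1.+1 by rewrite (ltn_predK ltN).
rewrite {1}NE /shifted_comp -NE ltnNge ltnW //= {1}NE subSn; last by rewrite -ltnS -NE.
move=> /genAc[g gA ->]; change (S (\sum_e x e * g e)); apply: subspace_sum => // e _.
have hy : B N.-1 (g e) by rewrite /shifted_comp ltnNge -ltnS -NE ltN.
have leN1 w : (rank w <= N.-1.+1)%N by rewrite -NE.
have Ki w : K w (N - rank w) (fund w (g e)).
  by have := solutions_fund (leN1 w) hy; rewrite -NE.
by rewrite edge_mulE; apply: (subspaceB sS); apply: KS.
Qed.

(** A component of positive degree of A is the direct sum of its [top_values]. *)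
Lemma dim_shifted_sum (h : nat -> nat) N : (forall k, has_dim (B k) (h k)) ->
  (max_rank P < N)%N -> h N = (\sum_v km v (N - rank v))%N.
Proof.
move=> hB ltN; apply: (has_dim_unique (hB N)).
apply: (has_dim_ext (fun y => iff_sym (shifted_top_values y ltN))).
have := @has_dim_bigsum F A P (index_enum P) (top_values N) (fun v => km v (N - rank v)).
apply; first exact: index_enum_uniq.
- exact: subspace_top_values.
- by move=> v; apply: top_values_dim.
move=> g hg g0 v _; have /choice[s hs] w : exists s, M w (N - rank w) s /\ g w = s (rank w).
  by have [s] := hg w; exists s.
have -> : g v = s v (rank v) by have [] := hs v.
rewrite (top_values_independent ltN (g := s)) // => [w|]; first by have [] := hs w.
by rewrite -[RHS]g0; apply: eq_bigr => w _; have [] := hs w.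
Qed.

(** The two ways to compute the dimension of K_v in degree n. *)
Lemma dim_solutions_sum (h : nat -> nat) v n : (forall k, has_dim (B k) (h k)) ->
  (\sum_(w | (w <= v)%O) km w n = \sum_(i < rank v) h (n + i))%N.
Proof.
move=> hB; apply/esym/(has_dim_unique (solutions_dim hB v n)).
rewrite -big_enum /=; set r := enum _.
have rP w : (w \in r) = (w <= v)%O by rewrite mem_enum.
have ur : uniq r := enum_uniq _.
apply: (has_dim_ext _ (has_dim_bigsum (M := fun w => M w n) ur _ _ _)) => //.
- move=> s; split=> [[g gM ->]|/solutions_decomp[g [gM g0 ->]]].
    rewrite big_seq; apply: subspace_sum => [|w]; first exact: subspace_solutions.
    by rewrite rP => lewv; apply: solutions_mono lewv (MK (gM w)).
  exists g => //; rewrite /r big_enum /= [RHS]big_mkcond; apply: eq_bigr => w _.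
  by case: ifP => // /negbT /g0.
- move=> g gM g0 w wr.
  have := @independentP n (fun w => if (w <= v)%O then g w else 0) _ _ w.
  rewrite -rP wr; apply=> [z|]; first by case: ifP => // _; apply: subspace0.
  by rewrite -big_mkcond -[RHS]g0 /r big_enum.
Qed.

End GradedRecurrences.

(** * Homogeneous elements of a free algebra *)

Section FreeAlgebra.
Variables (F : fieldType) (E : choiceType).
Local Notation W := {fmonom E}.
Local Notation T := {malg F[W]}.
Implicit Types (e : E) (m : W) (a b x y : T) (c : F) (p : seq E).

Definition gen e : T := << fmu e >>.

(** Over the edges of a poset this is convertible to [homogeneous]. *)
Definition is_homogeneous n x : Prop := forall m, m \in msupp x -> fdeg m = n.

Lemma malgUM c c' m m' :
  (<< c *g m >> : T) * << c' *g m' >> = << c * c' *g mmul m m' >>.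
Proof. by rewrite malgM_def fgmulUU. Qed.

Lemma malgUZ c m : (<< c *g m >> : T) = c *: << m >>.
Proof. by rewrite -mul_malgC malgUM mulr1 mul1m. Qed.

Lemma malg_spanned (S : T -> Prop) : S 0 -> (forall x y, S x -> S y -> S (x + y)) ->
  (forall c m, S << c *g m >>) -> forall x, S x.
Proof. by move=> S0 SD SU x; rewrite [x]monalgE; apply: big_ind. Qed.

Lemma monom_cons e p : FMonom (e :: p) = mmul (fmu e) (FMonom p) :> W.
Proof. by apply/eqP; rewrite fmP fmM fmU. Qed.

Lemma monomK m : FMonom (m : seq _) = m :> W.
Proof. by apply/eqP; rewrite fmP. Qed.

Lemma homogeneousP n x : is_homogeneous n x <-> forall m, size m <> n -> x@_m = 0.
Proof.
split=> [hx m nm|hx m]; last first.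
  by rewrite -mcoeff_neq0 => /eqP xm; apply: contrapT => /hx.
by apply/eqP; rewrite mcoeff_eq0; apply/negP => /hx.
Qed.

Lemma subspace_homogeneous n : subspace (fun x : T => is_homogeneous n x).
Proof.
split=> [|c x y]; first by apply/homogeneousP => m _; rewrite mcoeff0.
move=> /homogeneousP hx /homogeneousP hy; apply/homogeneousP => m nm.
by rewrite mcoeffD mcoeffZ hx // hy // mulr0 addr0.
Qed.

Lemma homogeneous0 n : is_homogeneous n (0 : T).
Proof. exact: subspace0 (subspace_homogeneous n). Qed.

Lemma homogeneousB n x y :
  is_homogeneous n x -> is_homogeneous n y -> is_homogeneous n (x - y).
Proof. exact: subspaceB (subspace_homogeneous n). Qed.

Lemma homogeneous_lin n c x y :
  is_homogeneous n x -> is_homogeneous n y -> is_homogeneous n (c *: x + y).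
Proof. exact: subspace_lin (subspace_homogeneous n). Qed.

Lemma homogeneousU c m : is_homogeneous (size m) (<< c *g m >> : T).
Proof.
apply/homogeneousP => m' nm; rewrite mcoeffU.
by case: eqP => // e; case: nm; rewrite e.
Qed.

Lemma homogeneous_spanned n (S : T -> Prop) : S 0 ->
  (forall x y, S x -> S y -> S (x + y)) ->
  (forall c m, size m = n -> S << c *g m >>) -> forall x, is_homogeneous n x -> S x.
Proof.
move=> S0 SD SU x hx; rewrite [x]monalgE big_seq; apply: big_ind => //.
by move=> m /hx hm; apply: SU.
Qed.

Lemma homogeneousM i j x y :
  is_homogeneous i x -> is_homogeneous j y -> is_homogeneous (i + j) (x * y).
Proof.
move=> hx hy; pose H := subspace_homogeneous (i + j).
move: x hx; apply: homogeneous_spanned => [|x x'|c m mi].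
- by rewrite mul0r; apply: subspace0 H.
- by rewrite mulrDl; apply: subspaceD.
move: y hy; apply: homogeneous_spanned => [|y y'|c' m' mj].
- by rewrite mulr0; apply: subspace0 H.
- by rewrite mulrDr; apply: subspaceD.
by rewrite malgUM -mi -mj -size_cat -fmM; apply: homogeneousU.
Qed.

Lemma homogeneous_gen e : is_homogeneous 1 (gen e).
Proof. by have := @homogeneousU 1 (fmu e); rewrite fmU. Qed.

Definition component n x : T := \sum_(m <- msupp x | size m == n) << x@_m *g m >>.

Lemma componentE n x m : (component n x)@_m = if size m == n then x@_m else 0.
Proof.
rewrite /component raddf_sum /=.
under eq_bigr do rewrite mcoeffU.
have [mx|mx] := boolP (m \in msupp x).
  rewrite big_mkcond (bigD1_seq m) ?fset_uniq //= eqxx big1 ?addr0 // => m' nm.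
  by rewrite (negbTE nm); case: ifP.
rewrite big_seq_cond big1 => [|m' /andP[m'x _]].
  by rewrite mcoeff_outdom // if_same.
by case: eqP => // e; rewrite -e m'x in mx.
Qed.

Lemma componentB n x y : component n (x - y) = component n x - component n y.
Proof.
apply/malgP => m; rewrite componentE.
move: (componentE n x m) (componentE n y m).
move: (component n x) (component n y) => cx cy ex ey.
by rewrite [RHS]mcoeffB ex ey mcoeffB; case: (size m == n) => //; rewrite subr0.
Qed.

Lemma component0 n : component n 0 = 0.
Proof. by apply/malgP => m; rewrite componentE mcoeff0 if_same. Qed.

Lemma componentD n x y : component n (x + y) = component n x + component n y.
Proof.
by have := componentB n x (- y); rewrite opprK -[- y]sub0r componentB component0 sub0r opprK.
Qed.

Lemma component_homogeneous n x : is_homogeneous n (component n x).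
Proof. by apply/homogeneousP => m /eqP/negbTE nm; rewrite componentE nm. Qed.

Lemma component_id n x : is_homogeneous n x -> component n x = x.
Proof.
move=> /homogeneousP hx; apply/malgP => m; rewrite componentE.
by case: eqP => // /hx ->.
Qed.

Lemma component_other n n' x : is_homogeneous n' x -> n' <> n -> component n x = 0.
Proof.
move=> /homogeneousP hx nn; apply/malgP => m; rewrite componentE mcoeff0.
by case: eqP => // e; apply: hx; rewrite e => /esym.
Qed.

(** The homogeneous part of degree k of (t - e_1) ... (t - e_n) in the letters,
    that is, the coefficient of t ^ (n - k). *)
Fixpoint path_coef p k : T :=
  if p is e :: p' then
    path_coef p' k - (if k is k'.+1 then gen e * path_coef p' k' else 0)
  else (k == 0%N)%:R.

Lemma path_coef_gt p k : (size p < k)%N -> path_coef p k = 0.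
Proof.
elim: p k => [|e p IH] [|k] //=; rewrite ltnS => ltk.
by rewrite !IH ?mulr0 ?subr0 // ltnW.
Qed.

Lemma path_coef0 p : path_coef p 0 = 1.
Proof. by elim: p => //= e p ->; rewrite subr0. Qed.

Lemma path_coef_homogeneous p k : is_homogeneous k (path_coef p k).
Proof.
elim: p k => [|e p IH] k /=.
  case: k => [|k] /=; last exact: subspace0 (subspace_homogeneous _).
  by have := @homogeneousU 1 mone; rewrite fm1.
apply: (subspaceB (subspace_homogeneous k)) => //.
case: k => [|k]; first exact: subspace0 (subspace_homogeneous _).
by rewrite -add1n; apply: homogeneousM => //; apply: homogeneous_gen.
Qed.

Definition word_poly p : {poly T} := \prod_(e <- p) ('X - (gen e)%:P).

Lemma word_polyE p i :
  (word_poly p)`_i = if (i <= size p)%N then path_coef p (size p - i)%N else 0.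
Proof.
elim: p i => [|e p IH] i; rewrite /word_poly.
  by rewrite big_nil coef1; case: i.
rewrite big_cons -/(word_poly p) mulrBl coefB coefXM coefCM /= !IH.
case: i => [|i] /=.
  by rewrite !subn0 [path_coef p _.+1]path_coef_gt.
rewrite subSS ltnS; have [lei|lti] := leqP i (size p); last first.
  by rewrite leqNgt ltnW //= mulr0 subr0.
congr (_ - _); have [lti|] := ltnP i (size p); first by rewrite -[in RHS](subnSK lti).
by move=> le; rewrite (_ : i = size p) ?subnn ?mulr0 //; apply/eqP; rewrite eqn_leq lei.
Qed.

End FreeAlgebra.

(** The induction principle for a property S of the ideal that need not be
    stable under multiplication: apply the universal property to the ideal of
    the x with S (a x b) for all a and b. *)
Lemma ideal_gen_ind (R : nzRingType) (rel S : R -> Prop) : S 0 ->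
  (forall x y, S x -> S y -> S (x - y)) ->
  (forall a s b, rel s -> S (a * s * b)) -> forall x, ideal_gen rel x -> S x.
Proof.
move=> S0 SB Srel x hx; rewrite -[x]mulr1 -[x]mul1r.
apply: (hx (fun x => forall a b, S (a * x * b))) => [|s hs a b]; last exact: Srel.
split=> [a b|y z hy hz a b|c y hy a b|c y hy a b].
- by rewrite mulr0 mul0r.
- by rewrite mulrBr mulrBl; apply: SB.
- by rewrite mulrA.
- by rewrite -!mulrA mulrA.
Qed.

Section FreeAlgebraIdeals.
Variables (F : fieldType) (E : choiceType).
Local Notation W := {fmonom E}.
Local Notation T := {malg F[W]}.
Implicit Types (m : W) (a b x y : T) (c : F).

Section Functional.
Variable h : W -> F.

Definition word_functional x : F := mmap idfun h x.

Lemma word_functionalD x y :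
  word_functional (x + y) = word_functional x + word_functional y.
Proof. exact: (@mmapD _ _ _ idfun). Qed.

Lemma word_functionalB x y :
  word_functional (x - y) = word_functional x - word_functional y.
Proof. exact: (@mmapB _ _ _ idfun). Qed.

Lemma word_functional0 : word_functional 0 = 0.
Proof. exact: (@mmap0 _ _ _ idfun). Qed.

Lemma word_functionalU c m : word_functional << c *g m >> = c * h m.
Proof. exact: (@mmapU _ _ _ idfun). Qed.

Lemma word_functionalZ c x : word_functional (c *: x) = c * word_functional x.
Proof.
move: x; apply: malg_spanned => [|x y|c' m].
- by rewrite scaler0 word_functional0 mulr0.
- move=> hx hy; rewrite scalerDr [LHS]word_functionalD hx hy.
  by rewrite [in RHS]word_functionalD mulrDr.
- by rewrite malgUZ scalerA -malgUZ word_functionalU -malgUZ word_functionalU mulrA.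
Qed.

End Functional.

(** An ideal generated by homogeneous elements is graded. *)
Lemma component_ideal (rel : T -> Prop) n x :
  (forall s, rel s -> exists k, is_homogeneous k s) ->
  ideal_gen rel x -> ideal_gen rel (component n x).
Proof.
move=> hrel; have [I0 IB Il Ir] := ideal_gen_ideal rel.
have ID y z : ideal_gen rel y -> ideal_gen rel z -> ideal_gen rel (y + z).
  move=> hy hz; rewrite -[z]opprK; apply: (IB _ _ hy).
  by rewrite -sub0r; apply: IB.
move: x; apply: (@ideal_gen_ind _ _ (fun x => ideal_gen rel (component n x))).
- by rewrite component0.
- by move=> y z; rewrite componentB; apply: IB.
move=> a s b hs; move: a; apply: malg_spanned => [|a a'|c m].
- by rewrite !mul0r component0.
- by rewrite !mulrDl componentD; apply: ID.
move: b; apply: malg_spanned => [|b b'|c' m'].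
- by rewrite mulr0 component0.
- by rewrite mulrDr componentD; apply: ID.
have [k sk] := hrel s hs.
have hk : is_homogeneous (size m + k + size m') (<< c *g m >> * s * << c' *g m' >>).
  by apply: homogeneousM; [apply: homogeneousM|]; try exact: homogeneousU.
have [<-|nk] := pselect (size m + k + size m' = n)%N.
  rewrite component_id //; apply: (Ir); apply: (Il).
  by move=> I _ hI; apply: hI.
by rewrite (component_other hk nk).
Qed.

End FreeAlgebraIdeals.

(** * The splitting algebra as a graded algebra *)

Section SplittingAlgebraStructure.
Variables (F : fieldType).
Context (d : Order.disp_t) (P : finRankedPOrderType d).
Local Notation T := {malg F[{fmonom (edge P)}]}.
Local Notation A := (splitting_algebra F P).
Local Notation edge_path_coef := (@path_coef F (edge P)).
Local Notation edge_word_poly := (@word_poly F (edge P)).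
Local Notation pi := (@sa_pi F d P).
Implicit Types (e : edge P) (p q : seq (edge P)) (u v w : P).

Lemma sa_pi_mul (x y : T) : pi (x * y) = pi x * pi y.
Proof. exact: esym (sa_piM x y). Qed.

Lemma sa_pi_scale (c : F) (x : T) : pi (c *: x) = c *: pi x.
Proof. exact: esym (sa_piZ c x). Qed.

Lemma sa_pi0 : pi 0 = 0.
Proof. by apply: (addrI (pi 0)); rewrite -sa_piD !addr0. Qed.

Lemma sa_pi_sub (x y : T) : pi (x - y) = pi x - pi y.
Proof. by apply: (addIr (pi y)); rewrite subrK -sa_piD subrK. Qed.

Lemma sa_pi_eq0 (x : T) : pi x = 0 <-> ideal_gen (@splitting_rel F d P) x.
Proof.
rewrite -sa_pi0; split=> [/sa_pi_eq|h].
  by rewrite subr0 => /asboolP.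
by apply/sa_pi_eq; rewrite subr0; apply/asboolP.
Qed.

Lemma splitting_rel_word_poly (x : T) : splitting_rel x <->
  exists v w p q i, [/\ p <> [::] /\ q <> [::], is_path v p w, is_path v q w &
    x = (edge_word_poly p)`_i - (edge_word_poly q)`_i].
Proof.
split=> [[e1 [s1 [e2 [s2 [i [/andP[h1 h2] et eh ->]]]]]]|].
  exists (etail e1), (ehead (last e1 s1)), (e1 :: s1), (e2 :: s2), i.
  by split=> //; apply/is_path_hasse.
move=> [v [w [[|e1 s1] [[|e2 s2] [i [[//= _ _]]]]]]] => // h1 h2 ->.
have /is_path_hasse[t1 p1 l1] := h1; have /is_path_hasse[t2 p2 l2] := h2.
exists e1, s1, e2, s2, i; split=> //; first exact/andP.
  by rewrite t1 t2.
by rewrite l1 l2.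
Qed.

Lemma is_path_size v w p q : is_path v p w -> is_path v q w -> size p = size q.
Proof. by move=> hp hq; apply: (@addnI (rank w)); rewrite -(is_path_rank hp) (is_path_rank hq). Qed.

Lemma splitting_rel_coef (x : T) : splitting_rel x ->
  exists v w p q k, [/\ is_path v p w, is_path v q w &
    x = edge_path_coef p k - edge_path_coef q k].
Proof.
move=> /splitting_rel_word_poly[v [w [p [q [i [_ hp hq ->]]]]]].
have sz := is_path_size hp hq; rewrite !word_polyE -sz.
exists v, w, p, q, (if (i <= size p)%N then size p - i else (size p).+1)%N.
by case: ifP => // _; split=> //; rewrite !path_coef_gt // -sz.
Qed.

Lemma splitting_rel_homogeneous (x : T) : splitting_rel x ->
  exists k, is_homogeneous k x.
Proof.
move=> /splitting_rel_coef[v [w [p [q [k [_ _ ->]]]]]]; exists k.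
exact: homogeneousB (@path_coef_homogeneous F _ p k) (@path_coef_homogeneous F _ q k).
Qed.

Definition edge_class e : A := pi (edge_gen F e).

Lemma sa_pi_step e (a b x : T) :
  pi ((a - edge_gen F e * b) * x) = pi (a * x) - edge_class e * pi (b * x).
Proof.
rewrite -sa_pi_mul -sa_pi_sub; congr pi; apply: etrans (mulrBl x a _) _.
exact: (congr1 (fun y => a * x - y) (esym (mulrA (edge_gen F e) b x))).
Qed.

Lemma step_poly_coef p i :
  (step_poly edge_class p)`_i = pi (edge_word_poly p)`_i.
Proof.
elim: p i => [|e p IH] i; rewrite /step_poly /word_poly.
  by rewrite !big_nil !coef1; case: (i == 0%N); rewrite ?sa_pi0.
rewrite !big_cons -/(step_poly _ p) -/(edge_word_poly p) !mulrBl !coefB !coefXM !coefCM.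
rewrite sa_pi_sub sa_pi_mul !IH; congr (_ - _).
by case: (i == 0%N); rewrite ?sa_pi0.
Qed.

Lemma step_poly_path v w p q : is_path v p w -> is_path v q w ->
  step_poly edge_class p = step_poly edge_class q.
Proof.
move=> hp hq; have sz := is_path_size hp hq.
case: p q sz hp hq => [|e p] [|e' q] // _ hp hq.
apply/polyP => i; rewrite !step_poly_coef; apply/eqP; rewrite -subr_eq0 -sa_pi_sub.
apply/eqP/sa_pi_eq0 => I _; apply; apply/splitting_rel_word_poly.
by exists v, w, (e :: p), (e' :: q), i.
Qed.

Lemma path_coef_class v w p q k : is_path v p w -> is_path v q w ->
  pi (edge_path_coef p k) = pi (edge_path_coef q k).
Proof.
move=> hp hq; have sz := is_path_size hp hq.
have [lek|ltk] := leqP k (size p); last by rewrite !path_coef_gt // -sz.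
have /(congr1 (fun r : {poly A} => r`_(size p - k)%N)) := step_poly_path hp hq.
by rewrite !step_poly_coef !word_polyE -sz leq_subr subKn.
Qed.

Local Notation Ac := (splitting_component F P).

Lemma subspace_component n : subspace (Ac n).
Proof.
split=> [|c _ _ [x hx ->] [y hy ->]].
  by exists 0; [exact: homogeneous0|rewrite sa_pi0].
exists (c *: x + y); last by rewrite sa_piD sa_pi_scale.
exact: homogeneous_lin hx hy.
Qed.

Lemma component_edge_mul e n y : Ac n y -> Ac n.+1 (edge_class e * y).
Proof.
move=> [x hx ->]; exists (edge_gen F e * x); last by rewrite sa_pi_mul.
by rewrite -add1n; apply: (homogeneousM (@homogeneous_gen F _ e) hx).
Qed.

Lemma component_generated n y : Ac n.+1 y ->
  exists2 g : edge P -> A, forall e, Ac n (g e) & y = \sum_e edge_class e * g e.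
Proof.
pose S y := exists2 g : edge P -> A, forall e, Ac n (g e) & y = \sum_e edge_class e * g e.
move=> [x hx ->]; change (S (pi x)).
move: x hx; apply: homogeneous_spanned => [|x y' [g hg gE] [g' hg' gE']|c m].
- exists (fun=> 0); first by move=> e; apply: subspace0 (subspace_component n).
  by rewrite big1 ?sa_pi0 // => e _; rewrite mulr0.
- exists (fun e => g e + g' e).
    by move=> e; apply: subspaceD (subspace_component n) _ _.
  by rewrite sa_piD gE gE' -big_split; apply: eq_bigr => e _; rewrite mulrDr.
- case: m => [[|e s]] //= [sz].
  exists (fun e' => if e' == e then pi (<< c *g FMonom s >> : T) else 0).
    move=> e'; case: eqP => [_|_]; last exact: subspace0 (subspace_component n).
    by exists (<< c *g FMonom s >> : T); rewrite // -sz; apply: homogeneousU.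
  rewrite (bigD1 e) //= eqxx big1 ?addr0 => [|e' /negbTE -> //]; last by rewrite mulr0.
  by rewrite /edge_class -sa_pi_mul malgUM mul1r -monom_cons.
Qed.

Lemma component_spanned n : finitely_spanned (Ac n).
Proof.
pose b (i : 'I_#|{: n.-tuple (edge P)}|) : A :=
  pi (<< FMonom (enum_val i : n.-tuple (edge P)) >> : T).
exists #|{: n.-tuple (edge P)}|, b; split=> [i|_ [x hx ->]].
  exists (<< FMonom (enum_val i : n.-tuple (edge P)) >> : T) => //.
  by have := @homogeneousU F _ 1 (FMonom (enum_val i : n.-tuple (edge P))); rewrite size_tuple.
move: x hx; apply: homogeneous_spanned => [|x y [c xE] [c' yE]|c m sz].
- by exists (fun=> 0); rewrite big1 ?sa_pi0 // => i _; rewrite scale0r.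
- exists (fun i => c i + c' i); rewrite sa_piD xE yE -big_split.
  by apply: eq_bigr => i _; rewrite scalerDl.
- have szt : size m == n by rewrite sz.
  pose t : n.-tuple (edge P) := Tuple szt.
  exists (fun i => if i == enum_rank t then c else 0).
  rewrite (bigD1 (enum_rank t)) //= eqxx big1 ?addr0 => [|i /negbTE -> //]; last by rewrite scale0r.
  by rewrite malgUZ sa_pi_scale /b enum_rankK /= monomK.
Qed.

Lemma component0_dim : has_dim (Ac 0) 1.
Proof.
exists (fun=> 1); split=> [_|c|_ [x hx ->]].
- exists 1 => //; have := @homogeneousU F _ 1 (mone : {fmonom (edge P)}).
  by rewrite fm1.
- rewrite big_ord1 => /eqP; rewrite scaler_eq0 oner_eq0 orbF => /eqP c0 i.
  by rewrite (ord1 i).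
move: x hx; apply: homogeneous_spanned => [|x y [c xE] [c' yE]|c m].
- by exists (fun=> 0); rewrite big_ord1 scale0r sa_pi0.
- exists (fun i => c i + c' i); rewrite sa_piD xE yE -big_split.
  by apply: eq_bigr => i _; rewrite scalerDl.
- move=> /size0nil m0; exists (fun=> c); rewrite big_ord1 malgUZ sa_pi_scale.
  by congr (_ *: _); congr pi; congr mkmalgU; apply/eqP; rewrite fmP m0 fm1.
Qed.

End SplittingAlgebraStructure.

(** * Functionals on the splitting algebra *)

Section Extension.
Variables (F : fieldType).
Context (d : Order.disp_t) (P : finRankedPOrderType d).
Variables (bot : P) (dp : P -> seq (edge P)).
Hypothesis bot_le : forall v : P, (bot <= v)%O.
Hypothesis dpP : forall v, is_path v (dp v) bot.
Hypothesis rank_bot : rank bot = 0%N.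

Local Notation T := {malg F[{fmonom (edge P)}]}.
Local Notation A := (splitting_algebra F P).
Local Notation edge_path_coef := (@path_coef F (edge P)).
Local Notation pi := (@sa_pi F d P).
Local Notation Ac := (splitting_component F P).
Local Notation ev := (@edge_class F d P).
Local Notation B := (shifted_comp P Ac).
Local Notation K := (solutions ev Ac dp).
Local Notation fund v := (fundamental ev (dp v)).
Implicit Types (e : edge P) (p q : seq (edge P)) (u v w : P).

Let sA := @subspace_component F d P.
Let xA := @component_edge_mul F d P.
Let pathA := @step_poly_path F d P.

Variables (m : nat) (f : P -> (nat -> A) -> F).
Let N := (max_rank P + m).+1.
Hypothesis lf : forall v, linear_on (K v (N - rank v)) (f v).
Hypothesis cf : forall e s, K (ehead e) (N - rank (etail e)) s ->
  f (etail e) s = f (ehead e) (shift s).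

Lemma class_shifted k y : Ac k y -> B (max_rank P + k)%N y.
Proof. by move=> hy; rewrite /shifted_comp ltnNge leq_addr /= addKn. Qed.

Lemma fund_solution v j k n y : Ac k y ->
  n = ((max_rank P + k).+1 - rank v + j)%N -> K v n (iter j shift (fund v y)).
Proof.
move=> hy ->; have le : (rank v <= (max_rank P + k).+1)%N.
  by rewrite leqW // (leq_trans (rank_max v)) // leq_addr.
exact: solutions_shift (solutions_fund sA xA bot_le dpP rank_bot pathA le (class_shifted hy)).
Qed.

Let sK v n : subspace (K v n) := subspace_solutions ev sA dp v n.

Let fundP v y : Ac m y -> K v (N - rank v) (fund v y).
Proof. by move=> hy; apply: (@fund_solution v 0 m); rewrite ?addn0. Qed.

Lemma functional0 v : f v 0 = 0.
Proof. exact: linear_on0 (sK _ _) (@lf v). Qed.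

(** The functional e y |-> f_v(fund_v(y)) - f_w(fund_w(y)) on the free algebra,
    for e from v to w and y of degree m; it is 0 in degrees other than m + 1. *)
Definition word_value (s : {fmonom (edge P)}) : F :=
  if (s : seq _) is e :: s' then
    if size s' == m then
      f (etail e) (fund (etail e) (pi (<< FMonom s' >> : T))) -
      f (ehead e) (fund (ehead e) (pi (<< FMonom s' >> : T)))
    else 0
  else 0.

Definition lifted_functional : T -> F := word_functional word_value.
Local Notation fhat := lifted_functional.

Lemma fhatD x y : fhat (x + y) = fhat x + fhat y.
Proof. exact: word_functionalD. Qed.
Lemma fhatB x y : fhat (x - y) = fhat x - fhat y.
Proof. exact: word_functionalB. Qed.
Lemma fhat0 : fhat 0 = 0.
Proof. exact: word_functional0. Qed.

Definition pushed v (x : T) : F := f v (fund v (pi (component m x))).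

Lemma component_class k (x : T) : is_homogeneous k x -> Ac k (pi x).
Proof. by exists x. Qed.

Lemma pushedD v x y : pushed v (x + y) = pushed v x + pushed v y.
Proof.
have hx := component_class (@component_homogeneous F _ m x).
have hy := component_class (@component_homogeneous F _ m y).
rewrite /pushed componentD sa_piD -(linear_onD (@lf v) (fundP v hx) (fundP v hy)).
by rewrite (fundD ev dpP rank_bot).
Qed.

Lemma pushedU v c s : pushed v << c *g s >> =
  if size s == m then c * f v (fund v (pi (<< s >> : T))) else 0.
Proof.
rewrite /pushed; have hs := @homogeneousU F _ c s.
case: eqP => [sm|nsm].
  rewrite component_id -?sm // malgUZ sa_pi_scale.
  have hs1 : Ac m (pi (<< s >> : T)).
    by rewrite -sm; apply: component_class; apply: homogeneousU.
  rewrite -(linear_onZ c (sK _ _) (@lf v) (fundP v hs1)).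
  by rewrite (fundZ ev dpP rank_bot).
by rewrite (component_other hs nsm) sa_pi0 (fund0 ev dpP rank_bot) functional0.
Qed.

Lemma lifted_edge e x :
  fhat (edge_gen F e * x) = pushed (etail e) x - pushed (ehead e) x.
Proof.
move: x; apply: malg_spanned => [|x y hx hy|c s].
- rewrite mulr0 fhat0 /pushed component0 sa_pi0 !(fund0 ev dpP rank_bot).
  by rewrite !functional0 subrr.
- have e1 : fhat (edge_gen F e * (x + y)) = fhat (edge_gen F e * x) + fhat (edge_gen F e * y).
    by rewrite mulrDr; apply: fhatD.
  apply: etrans e1 _; apply: etrans (congr2 +%R hx hy) _.
  by rewrite (pushedD (etail e) x y) (pushedD (ehead e) x y) opprD addrACA.
- rewrite malgUM mul1r /fhat word_functionalU !pushedU /word_value fmM fmU /= monomK.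
  by case: eqP => _; rewrite ?mulrBr ?mulr0 ?subr0.
Qed.

Lemma pushed_id v x : is_homogeneous m x -> pushed v x = f v (fund v (pi x)).
Proof. by move=> hx; rewrite /pushed component_id. Qed.

(** The value of the functional on b_(k+1) x, for b_j the part of degree j of
    the path polynomial: in A it follows from comparing coefficients in
    P_v^-1 P_(v,w) = P_w^-1. The right hand side involves the path only through
    its ends and the classes of the b_j in A, so that the functional cannot
    distinguish two paths with the same ends. The proof is by induction on the
    path; the terms for its first edge telescope by [iter_fund_shift] and the
    compatibility of f. *)
Lemma lifted_path_coef v p w k l (x : T) : is_path v p w ->
  is_homogeneous l x -> (k + l = m)%N ->
  fhat (edge_path_coef p k.+1 * x) = f w (iter k shift (fund w (pi x))) -
    \sum_(j < k.+1) f v (iter j shift (fund v (pi (edge_path_coef p (k - j)%N * x)))).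
Proof.
move=> hp hx klm; elim: p v hp => [|e p IH] v; rewrite [is_path _ _ _]/=.
  move/eqP ->; rewrite mul0r fhat0 big_ord_recr /= subnn mul1r.
  rewrite big1 ?add0r ?subrr // => j _.
  by rewrite subn_eq0 leqNgt ltn_ord /= mul0r sa_pi0 (fund0 ev dpP rank_bot) iter_shift0 functional0.
case/andP=> /eqP <- hp; have {}IH := IH _ hp.
set t := etail e; set u := ehead e in hp IH *.
have tu : rank t = (rank u).+1 by apply: edge_rank.
have hz j : is_homogeneous (j + l) (edge_path_coef p j * x).
  by apply: homogeneousM => //; apply: path_coef_homogeneous.
pose z j := pi (edge_path_coef p j * x).
have Az j : Ac (j + l) (z j) by apply: component_class.
have hm : is_homogeneous m (edge_path_coef p k * x) by rewrite -klm.
(* b_(k-j) of the path e :: p is b_(k-j) - e b_(k-j-1) for the path p. *)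
have fE j : (j <= k)%N ->
    f t (iter j shift (fund t (pi (edge_path_coef (e :: p) (k - j)%N * x)))) =
    f t (iter j shift (fund t (z (k - j)%N))) -
    (if (j < k)%N then f t (iter j shift (fund t (ev e * z (k - j.+1)%N))) else 0).
  move=> lejk.
  have [ltjk|lekj] := ltnP j k; last first.
    have -> : j = k by apply/eqP; rewrite eqn_leq lejk.
    by rewrite subnn /= !subr0.
  have At : K t (N - rank t) (iter j shift (fund t (z (k - j)%N))).
    by apply: (fund_solution (Az (k - j)%N)); have := rank_max t; rewrite /N; lia.
  have Bt : K t (N - rank t) (iter j shift (fund t (ev e * z (k - j.+1)%N))).
    by apply: (fund_solution (xA e (Az (k - j.+1)%N))); have := rank_max t; rewrite /N; lia.
  have := linear_onB (@lf t) At Bt; rewrite -iter_shiftB -(fundB ev dpP rank_bot) => <-.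
  congr (f t (iter j shift (fund t _))).
  have -> : edge_path_coef (e :: p) (k - j)%N =
      edge_path_coef p (k - j)%N - edge_gen F e * edge_path_coef p (k - j.+1)%N.
    by rewrite -(subnSK ltjk).
  exact: sa_pi_step.
have step j : (j < k)%N ->
    f t (iter j.+1 shift (fund t (z (k - j.+1)%N))) -
    f t (iter j shift (fund t (ev e * z (k - j.+1)%N))) =
    f u (iter j.+1 shift (fund u (z (k - j.+1)%N))).
  move=> ltjk; have Rt := rank_max t.
  have hu : K u (N - rank t) (iter j shift (fund u (z (k - j.+1)%N))).
    by apply: (fund_solution (Az (k - j.+1)%N)); rewrite /N; lia.
  have ht : K t (N - rank t) (iter j shift (fund t (ev e * z (k - j.+1)%N))).
    by apply: (fund_solution (xA e (Az (k - j.+1)%N))); rewrite /N; lia.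
  rewrite -[in RHS]/(shift (iter j shift _)) -(@cf e _ hu) (iter_fund_shift dpP rank_bot pathA).
  by rewrite (linear_onD (@lf t) ht (solutions_edge dpP pathA hu)) addrC addKr.
have e1 : edge_path_coef (e :: p) k.+1 * x =
    edge_path_coef p k.+1 * x - edge_gen F e * (edge_path_coef p k * x).
  apply: etrans (mulrBl x _ _) _.
  exact: (congr1 (fun y => edge_path_coef p k.+1 * x - y) (esym (mulrA (edge_gen F e) _ x))).
have e2 : fhat (edge_gen F e * (edge_path_coef p k * x)) =
    f t (fund t (z k)) - f u (fund u (z k)).
  apply: etrans (lifted_edge e _) _.
  exact: (congr2 (fun a b => a - b) (pushed_id t hm) (pushed_id u hm)).
apply: etrans (congr1 fhat e1) _; apply: etrans (fhatB _ _) _.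
apply: etrans (congr2 (fun a b => a - b) IH e2) _.
under [in RHS]eq_bigr => j _ do rewrite (fE j (ltn_ord j)).
rewrite sumrB.
pose Tj j := f t (iter j shift (fund t (z (k - j)%N))).
pose Uj j := f u (iter j shift (fund u (z (k - j)%N))).
pose Ej j := f t (iter j shift (fund t (ev e * z (k - j.+1)%N))).
have -> : \sum_(j < k.+1) (if (j < k)%N then Ej j else 0) = \sum_(j < k) Ej j.
  rewrite big_ord_recr /= ltnn addr0; apply: eq_bigr => j _.
  by rewrite ltn_ord.
have -> : \sum_(j < k.+1) f u (iter j shift (fund u (z (k - j)%N))) =
    Uj 0%N + (\sum_(j < k) Tj j.+1 - \sum_(j < k) Ej j).
  rewrite big_ord_recl -sumrB; congr (_ + _).
  by apply: eq_bigr => j _; rewrite [RHS]step.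
have -> : \sum_(j < k.+1) f t (iter j shift (fund t (z (k - j)%N))) =
    Tj 0%N + \sum_(j < k) Tj j.+1.
  by rewrite big_ord_recl.
have -> : f t (fund t (z k)) = Tj 0%N by rewrite /Tj subn0.
have -> : f u (fund u (z k)) = Uj 0%N by rewrite /Uj subn0.
have alg (a b c g h : F) : a - (c + (g - h)) - (b - c) = a - (b + g - h) by ring.
exact: alg.
Qed.

Lemma lifted_other l (x : T) : is_homogeneous l x -> l <> m.+1 -> fhat x = 0.
Proof.
move=> hx nl; move: x hx; apply: homogeneous_spanned => [|x y hx hy|c s sl].
- exact: fhat0.
- by apply: etrans (fhatD _ _) _; apply: etrans (congr2 +%R hx hy) _; rewrite addr0.
- apply: etrans (word_functionalU _ _ _) _; rewrite /word_value.
  case: (s : seq _) sl => [|e s'] /=; first by rewrite mulr0.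
  by move=> sl; case: eqP => [sm|_]; rewrite ?mulr0 //; case: nl; rewrite -sl sm.
Qed.

Lemma fhatZ c (x : T) : fhat (c *: x) = c * fhat x.
Proof. exact: word_functionalZ. Qed.

Lemma lifted_rel (r b : T) : splitting_rel r -> fhat (r * b) = 0.
Proof.
move=> /splitting_rel_coef[v [w [p [q [k [hp hq ->]]]]]].
move: b; apply: malg_spanned => [|b b' hb hb'|c s].
- by rewrite mulr0 fhat0.
- apply: etrans (congr1 fhat (mulrDr _ _ _)) _; apply: etrans (fhatD _ _) _.
  by apply: etrans (congr2 +%R hb hb') _; rewrite addr0.
have hs := @homogeneousU F _ c s; set x := << c *g s >> in hs *.
have hk (p' : seq (edge P)) : is_homogeneous (k + size s) (edge_path_coef p' k * x).
  by apply: homogeneousM => //; apply: path_coef_homogeneous.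
apply: etrans (congr1 fhat (mulrBl x _ _)) _; apply: etrans (fhatB _ _) _.
apply/eqP; rewrite subr_eq0; apply/eqP.
have [ksm|nksm] := eqVneq (k + size s)%N m.+1; last first.
  have /eqP nk := nksm.
  exact: etrans (lifted_other (hk p) nk) (esym (lifted_other (hk q) nk)).
case: k ksm hk => [|k] ksm hk; first by rewrite !path_coef0.
have ksm' : (k + size s)%N = m by case: ksm.
apply: etrans (lifted_path_coef hp hs ksm') _.
apply: etrans _ (esym (lifted_path_coef hq hs ksm')).
apply: (congr1 (fun S => f w (iter k shift (fund w (pi x))) - S)).
apply: eq_bigr => j _; apply: (congr1 (fun y => f v (iter j shift (fund v y)))).
have e := path_coef_class F (k - j)%N hp hq.
apply: etrans (sa_pi_mul _ x) _; apply: etrans _ (esym (sa_pi_mul _ x)).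
exact: (f_equal2 *%R e (erefl (pi x))).
Qed.

(** Products a r b, for r a relation: when a is a scalar this is [lifted_rel];
    when a starts with an edge e the value is expressed by the class of the
    rest of the product, which is 0 in A. *)
Lemma lifted_ideal (x : T) : ideal_gen (@splitting_rel F d P) x -> fhat x = 0.
Proof.
move: x; apply: (@ideal_gen_ind _ _ (fun x => fhat x = 0)) => [|x y hx hy|a r b hr].
- exact: fhat0.
- by apply: etrans (fhatB _ _) _; apply: etrans (congr2 (fun a b => a - b) hx hy) _; rewrite subrr.
have [_ _ Il Ir] := ideal_gen_ideal (@splitting_rel F d P).
apply: etrans (congr1 fhat (esym (mulrA a r b))) _.
move: a; apply: malg_spanned => [|a a' ha ha'|c s].
- by rewrite mul0r fhat0.
- apply: etrans (congr1 fhat (mulrDl _ _ _)) _; apply: etrans (fhatD _ _) _.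
  by apply: etrans (congr2 +%R ha ha') _; rewrite addr0.
rewrite -(monomK s); case: (s : seq _) => [|e s'].
  have -> : (<< c *g FMonom [::] >> : T) = c *: 1.
    by rewrite malgUZ; congr (_ *: _); congr mkmalgU; apply/eqP; rewrite fmP fm1.
  apply: etrans (congr1 fhat (etrans (esym (scalerAl c 1 _)) (congr1 _ (mul1r _)))) _.
  by apply: etrans (fhatZ _ _) _; apply: etrans (congr1 _ (lifted_rel b hr)) _; rewrite mulr0.
have e1 : (<< c *g FMonom (e :: s') >> : T) * (r * b) =
    edge_gen F e * (<< c *g FMonom s' >> * (r * b)).
  by rewrite monom_cons -[c]mul1r -malgUM mul1r; apply: esym (mulrA _ _ _).
apply: etrans (congr1 fhat e1) _; apply: etrans (lifted_edge e _) _.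
have I0 : pi (component m (<< c *g FMonom s' >> * (r * b))) = 0.
  apply/sa_pi_eq0.
  apply: (@component_ideal F (edge P) (@splitting_rel F d P) m _ (@splitting_rel_homogeneous F d P)).
  by apply: (Il); apply: (Ir) => I _ hI; apply: hI.
by rewrite /pushed I0 !(fund0 ev dpP rank_bot) !functional0 subrr.
Qed.

Lemma extension_exists : exists2 fb : A -> F, linear_on (B N) fb &
  forall e y, B N.-1 y ->
    fb (ev e * y) = f (etail e) (fund (etail e) y) - f (ehead e) (fund (ehead e) y).
Proof.
pose fb (a : A) := fhat (repr a).
have fbE (x : T) : fb (pi x) = fhat x.
  apply/eqP; rewrite -subr_eq0 /fb -fhatB; apply/eqP/lifted_ideal/sa_pi_eq0.
  by rewrite sa_pi_sub sa_piK subrr.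
exists fb => [c a b _ _|e y].
  rewrite -[a]sa_piK -[b]sa_piK -sa_pi_scale -sa_piD !fbE.
  by apply: etrans (fhatD _ _) _; rewrite fhatZ.
rewrite /N /= /shifted_comp ltnNge leq_addr /= addKn => -[x hx ->].
rewrite -sa_pi_mul fbE; apply: etrans (lifted_edge e x) _.
by rewrite !pushed_id.
Qed.

End Extension.

(** * Dimensions and the Moebius function *)

(** Here k v n is the dimension of M_v in degree n, and h the translated
    Hilbert function. *)
Lemma splitting_dimensions (F : fieldType) (d : Order.disp_t)
    (P : finRankedPOrderType d) : (exists! p : P, minimal p) ->
  exists (H : nat -> nat) (k : P -> nat -> nat),
    let h j := if (j < max_rank P)%N then 0%N else H (j - max_rank P)%N in
    [/\ forall n, has_dim (splitting_component F P n) (H n), H 0%N = 1%N,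
      forall v n, (\sum_(w | (w <= v)%O) k w n = \sum_(i < rank v) h (n + i))%N &
      forall N, (max_rank P < N)%N -> h N = (\sum_v k v (N - rank v))%N].
Proof.
move=> /unique_minimal_bottom[bot rank_bot bot_le].
have /choice[dp dpP] v : exists p, is_path v p bot by apply: exists_path.
have sA := @subspace_component F d P.
have xA := @component_edge_mul F d P.
have pathA := @step_poly_path F d P.
have /choice[H HP] n : exists k, has_dim (splitting_component F P n) k.
  by apply: has_dim_exists (sA n) (component_spanned _ _ n).
pose h j := if (j < max_rank P)%N then 0%N else H (j - max_rank P)%N.
have hB k : has_dim (shifted_comp P (splitting_component F P) k) (h k).
  rewrite /shifted_comp /h; case: (k < max_rank P)%N; last exact: HP.
  by apply: has_dim_trivial.
pose K := solutions (@edge_class F d P) (splitting_component F P) dp.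
pose Klow := lower_solutions (@edge_class F d P) (splitting_component F P) dp.
have /choice[Mk MkP] (vn : P * nat) : exists Mk : ((nat -> splitting_algebra F P) -> Prop) * nat,
    [/\ subspace Mk.1, forall x, Mk.1 x -> K vn.1 vn.2 x, has_dim Mk.1 Mk.2,
      forall x, K vn.1 vn.2 x -> exists u y, [/\ Klow vn.1 vn.2 u, Mk.1 y & x = u + y] &
      forall x, Klow vn.1 vn.2 x -> Mk.1 x -> x = 0].
  have sK : subspace (K vn.1 vn.2) by apply: subspace_solutions.
  have sKl : subspace (Klow vn.1 vn.2) by apply: subspace_lower.
  have KlK s : Klow vn.1 vn.2 s -> K vn.1 vn.2 s by apply: lower_solutionsW.
  have fK : finitely_spanned (K vn.1 vn.2).
    exact: (solutions_spanned sA xA bot_le dpP rank_bot pathA vn.1 vn.2 hB).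
  have [M [k [M1 M2 M3 M4 M5]]] := subspace_complement sK sKl KlK fK.
  by exists (M, k); split.
have ext N f : (max_rank P < N)%N -> (forall v, linear_on (K v (N - rank v)%N) (f v)) ->
  (forall e s, K (ehead e) (N - rank (etail e))%N s -> f (etail e) s = f (ehead e) (shift s)) ->
  exists2 fb : splitting_algebra F P -> F,
    linear_on (shifted_comp P (splitting_component F P) N) fb &
    forall e y, shifted_comp P (splitting_component F P) N.-1 y ->
    fb (edge_class F e * y) =
    f (etail e) (fundamental (@edge_class F d P) (dp (etail e)) y) -
    f (ehead e) (fundamental (@edge_class F d P) (dp (ehead e)) y).
  move=> ltN; have -> : N = (max_rank P + (N.-1 - max_rank P)).+1%N.
    by rewrite subnKC ?(ltn_predK ltN) // -ltnS (ltn_predK ltN).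
  exact: (extension_exists bot_le dpP rank_bot).
pose M v n := (Mk (v, n)).1; pose k v n := (Mk (v, n)).2.
have sM v n : subspace (M v n) by case: (MkP (v, n)).
have MK v n s : M v n s -> K v n s by case: (MkP (v, n)) => _ + _ _ _; apply.
have dM v n : has_dim (M v n) (k v n) by case: (MkP (v, n)).
have Ms v n s : K v n s -> exists u y, [/\ Klow v n u, M v n y & s = u + y].
  by case: (MkP (v, n)) => _ _ _ + _; apply.
have Ml v n s : Klow v n s -> M v n s -> s = 0 by case: (MkP (v, n)) => _ _ _ _; apply.
have fB : exists h, forall k, has_dim (shifted_comp P (splitting_component F P) k) (h k).
  by exists h.
exists H, k; split=> //.
- exact: has_dim_unique (HP 0%N) (component0_dim F P).
- move=> v n.
  exact: (dim_solutions_sum sA xA bot_le dpP rank_bot pathA ext sM MK dM Ms Ml fB v n hB).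
- have gA := @component_generated F d P; move=> N.
  exact: (dim_shifted_sum sA xA bot_le dpP rank_bot pathA gA ext sM MK dM Ms Ml fB hB).
Qed.

Section MoebiusInversion.
Context (d : Order.disp_t) (P : finRankedPOrderType d).
Implicit Types (p q u v w : P).

Lemma sum_moebius p q : (p <= q)%O ->
  \sum_(r | (p <= r <= q)%O) moebius p r = (p == q)%:R :> int.
Proof.
rewrite le_eqVlt => /orP[/eqP <-|ltpq].
  rewrite eqxx (bigD1 p) ?lexx //= moebius_id big1 ?addr0 // => r.
  by case/andP=> /le_anti -> /eqP.
rewrite (lt_eqF ltpq) (bigD1 q) ?lexx ?(ltW ltpq) //= (moebius_lt ltpq).
apply/eqP; rewrite addrC subr_eq0; apply/eqP; apply: eq_bigl => r.
by rewrite [in RHS]lt_neqAle andbA andbAC.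
Qed.

(** Reading the relation at q determines f p q from the f p r with r < q. *)
Lemma moebius_unique (f : P -> P -> int) :
  (forall p q, ~~ (p <= q)%O -> f p q = 0) ->
  (forall p q, (p <= q)%O -> \sum_(r | (p <= r <= q)%O) f p r = (p == q)%:R) ->
  forall p q, moebius p q = f p q.
Proof.
move=> f0 fsum p q; have [n] := ubnP (rank q); elim: n => // n IH in q * => ltq.
have [lepq|nle] := boolP (p <= q)%O; last by rewrite f0 // moebius_nle.
have := sum_moebius lepq; rewrite -(fsum _ _ lepq).
rewrite (bigD1 q) ?lepq ?lexx //= [in RHS](bigD1 q) ?lepq ?lexx //=.
rewrite (eq_bigr (f p)); first by move/addIr.
move=> r /andP[/andP[_ lerq] nrq]; apply: IH; rewrite -ltnS; apply: leq_trans ltq.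
by rewrite ltnS rank_lt // lt_neqAle nrq.
Qed.

(** The right hand side has the required sums, by the defining relation of the
    Moebius function, and g is determined by them. *)
Lemma moebius_inversion (g G : P -> int) :
  (forall v, \sum_(w | (w <= v)%O) g w = G v) ->
  forall v, g v = \sum_(w | (w <= v)%O) moebius w v * G w.
Proof.
move=> gG; pose g' v := \sum_(w | (w <= v)%O) moebius w v * G w.
have g'G v : \sum_(u | (u <= v)%O) g' u = G v.
  rewrite (exchange_big_dep (fun w => (w <= v)%O)) => [|u w leuv lewu]; last exact: le_trans leuv.
  rewrite (bigD1 v) //= [X in _ + X]big1 => [|w /andP[lewv nwv]]; last first.
    rewrite -mulr_suml (eq_bigl (fun u => (w <= u <= v)%O)) => [|u]; last by rewrite andbC.
    by rewrite sum_moebius // (negbTE nwv) mul0r.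
  rewrite addr0 -mulr_suml (eq_bigl (fun u => (v <= u <= v)%O)) => [|u]; last by rewrite andbC.
  by rewrite sum_moebius // eqxx mul1r.
move=> v; rewrite -/(g' v); have [n] := ubnP (rank v); elim: n => // n IH in v * => ltv.
have := gG v; rewrite -(g'G v) (bigD1 v) //= [in RHS](bigD1 v) //=.
rewrite (eq_bigr g') => [/addIr //|w /andP[lewv nwv]]; apply: IH.
by rewrite -ltnS; apply: leq_trans ltv; rewrite ltnS rank_lt // lt_neqAle nwv.
Qed.

Lemma moebius_polyE : moebius_poly P =
  \sum_(v : P) \sum_(w : P | (w <= v)%O) moebius w v *: 'X^(rank v - rank w)%N.
Proof.
by rewrite (exchange_big_dep predT) //= pair_big_dep.
Qed.

Section SeriesOfDimensions.
Variables (bot : P) (H : nat -> nat) (k : P -> nat -> nat).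
Hypothesis rank_bot : rank bot = 0%N.
Hypothesis bot_le : forall v, (bot <= v)%O.
Let R := max_rank P.
Let h j := if (j < R)%N then 0%N else H (j - R)%N.
Hypothesis H0 : H 0%N = 1%N.
Hypothesis dimK : forall v n,
  (\sum_(w | (w <= v)%O) k w n = \sum_(i < rank v) h (n + i))%N.
Hypothesis dimB : forall N, (R < N)%N -> h N = (\sum_v k v (N - rank v))%N.

Let C j : int := \sum_(i < j) (h i)%:Z.
Let c j : int := \sum_(i < j.+1) (H i)%:Z.

Lemma C_addn n r : C (n + r)%N = C n + \sum_(i < r) (h (n + i)%N)%:Z.
Proof. by rewrite /C big_split_ord. Qed.

Lemma C_small j : (j <= R)%N -> C j = 0.
Proof.
move=> lej; rewrite /C big1 // => i _.
by rewrite /h (leq_trans (ltn_ord i)).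
Qed.

Lemma C_shift j : C (R + j.+1)%N = c j.
Proof.
rewrite C_addn (C_small (leqnn R)) add0r; apply: eq_bigr => i _.
by rewrite /h ltnNge leq_addr /= addKn.
Qed.

(** Adding C n at bot turns the hypothesis on k into sums over the principal
    ideals of P with the values C (n + |v|). *)
Lemma k_moebius v n :
  (k v n)%:Z + (if v == bot then C n else 0) =
  \sum_(w | (w <= v)%O) moebius w v * C (n + rank w)%N.
Proof.
apply: (moebius_inversion (g := fun v => (k v n)%:Z + (if v == bot then C n else 0))
  (G := fun v => C (n + rank v)%N)) => u.
rewrite big_split /= -big_mkcondr /= C_addn addrC; congr (_ + _).
  rewrite (eq_bigl (pred1 bot)) ?big_pred1_eq // => w /=.
  by case: eqP => [->|_]; rewrite ?bot_le ?andbF.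
have := congr1 Posz (dimK u n); rewrite !(big_morph Posz PoszD (erefl _)) //.
Qed.

(** Sum [k_moebius] over all v, in degree N - |v|: the left hand side becomes
    h N + C N = C (N + 1), and the right hand side the convolution with the
    coefficients of the Moebius polynomial. *)
Lemma c_recursion n : c n.+1 =
  \sum_(i < n.+1) (moebius_poly P)`_i * c (n - i)%N.
Proof.
pose N := (R + n.+1)%N.
have ltN : (R < N)%N by rewrite /N; lia.
have leR v : (rank v <= R)%N := rank_max v.
have -> : c n.+1 = \sum_(v : P) \sum_(w : P | (w <= v)%O)
    moebius w v * C (N - rank v + rank w)%N.
  rewrite -C_shift addnS -addn1 C_addn big_ord1 addn0 -/N (dimB ltN).
  rewrite (big_morph Posz PoszD (erefl _)) addrC.
  under [RHS]eq_bigr => v _ do rewrite -k_moebius.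
  by rewrite big_split /= -big_mkcond big_pred1_eq rank_bot subn0.
rewrite moebius_polyE.
under [RHS]eq_bigr do rewrite coef_sum mulr_suml.
rewrite exchange_big; apply: eq_bigr => v _ /=.
under [RHS]eq_bigr do rewrite coef_sum mulr_suml.
rewrite exchange_big; apply: eq_bigr => w lewv /=.
have lerw := rank_le lewv; have := leR v; move=> lev.
under [RHS]eq_bigr do rewrite coefZ coefXn -mulrA.
rewrite -mulr_sumr; congr (_ * _).
(* Terms with |v| - |w| > n vanish on both sides, as C is 0 up to R. *)
have [led|ltd] := leqP (rank v - rank w) n.
  rewrite (bigD1 (inord (rank v - rank w) : 'I_n.+1)) //= inordK // eqxx mul1r.
  rewrite big1 ?addr0 => [|i ni]; last first.
    rewrite (_ : _ == _ = false) ?mul0r //; apply: contraNF ni => /eqP <-.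
    by rewrite inord_val.
  by rewrite -C_shift; congr C; rewrite /N; lia.
rewrite big1 ?C_small // => [|i _]; first by rewrite /N; lia.
rewrite (_ : _ == _ = false) ?mul0r //; apply/negbTE; have := ltn_ord i; lia.
Qed.

Lemma dimensions_series :
  is_series_quotient (fun n => (H n)%:Z) (1 - 'X) (1 - 'X * moebius_poly P).
Proof.
set M := moebius_poly P.
have q0 : (1 - 'X * M)`_0 = 1 by rewrite coefB coef1 coefXM subr0.
have qS i : (1 - 'X * M)`_i.+1 = - M`_i by rewrite coefB coef1 coefXM sub0r.
split=> // -[|n]; first by rewrite big_ord1 q0 H0 coefB coef1 coefX subr0.
have HS m : (H m.+1)%:Z = c m.+1 - c m.
  by rewrite /c [X in X - _]big_ord_recr /= addrAC subrr add0r.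
rewrite big_ord_recl q0 mul1r subn0.
under eq_bigr => i _ do rewrite lift0 qS subSS mulNr.
rewrite sumrN HS c_recursion -/M; case: n => [|n].
  by rewrite !big_ord1 /c big_ord1 H0 coefB coef1 coefX mulr1 addrAC subrr.
rewrite [X in _ - _ - X]big_ord_recr [X in X - _ - _]big_ord_recr /= subnn c_recursion.
have -> : c 0 = 1 by rewrite /c big_ord1 H0.
rewrite H0 coefB coef1 coefX subr0.
have -> : \sum_(i < n.+1) M`_i * (H (n.+1 - i)%N)%:Z =
    \sum_(i < n.+1) M`_i * c (n.+1 - i)%N - \sum_(i < n.+1) M`_i * c (n - i)%N.
  rewrite -sumrB; apply: eq_bigr => i _; rewrite -mulrBr subSn ?HS //.
  by rewrite -ltnS.
have alg (a b m : int) : a + m * 1 - b - (a - b + m * 1) = 0 by ring.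
exact: alg.
Qed.

End SeriesOfDimensions.
End MoebiusInversion.

Lemma splitting_hilbert_series (F : fieldType) (d : Order.disp_t)
    (P : finRankedPOrderType d) : (exists! p : P, minimal p) ->
  exists H : nat -> nat,
    is_hilbert_series (splitting_component F P) H /\
    is_series_quotient (fun n => (H n)%:Z) (1 - 'X) (1 - 'X * moebius_poly P).
Proof.
move=> minP; have [bot rank_bot bot_le] := unique_minimal_bottom minP.
have [H [k [dimH H0 dimK dimB]]] := splitting_dimensions F minP.
by exists H; split=> //; apply: (dimensions_series rank_bot bot_le H0 dimK dimB).
Qed.

(** * Products of posets *)

Section Product.
Context (dP dQ : Order.disp_t).
Variables (P : finRankedPOrderType dP) (Q : finRankedPOrderType dQ).

Lemma product_rank (x : P *p Q) : rank x = (rank x.1 + rank x.2)%N.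
Proof. by []. Qed.

Lemma product_unique_minimal :
  (exists! p : P, minimal p) -> (exists! q : Q, minimal q) ->
  exists! x : P *p Q, minimal x.
Proof.
move=> [p [pmin puniq]] [q [qmin quniq]]; exists (p, q); split.
  by apply/(@rank_eq0 _ (P *p Q)); rewrite product_rank /= (proj2 (rank_eq0 p) pmin) (proj2 (rank_eq0 q) qmin).
move=> [p' q'] /(@rank_eq0 _ (P *p Q)); rewrite product_rank /=.
move=> /eqP; rewrite addn_eq0 => /andP[/eqP/rank_eq0/puniq -> /eqP/rank_eq0/quniq ->].
by [].
Qed.

(** The product of the Moebius functions satisfies the defining relation,
    since an interval of P * Q is a product of intervals. *)
Lemma moebius_product (x y : P *p Q) :
  moebius x y = moebius x.1 y.1 * moebius x.2 y.2.
Proof.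
apply: (moebius_unique (f := fun x y : P *p Q => moebius x.1 y.1 * moebius x.2 y.2)).
  move=> {x y} x y; rewrite leEprod negb_and => /orP[] nle; rewrite (moebius_nle nle).
    by rewrite mul0r.
  by rewrite mulr0.
move=> {x y} [p q] [p' q']; rewrite leEprod /= => /andP[lep leq].
have -> : ((p, q) == (p', q') :> (P *p Q)) = (p == p') && (q == q') by [].
rewrite -mulnb natrM -(sum_moebius lep) -(sum_moebius leq) big_distrlr /= pair_big_dep /=.
by apply: eq_big => -[r s] //=; rewrite !leEprod /= andbACA.
Qed.

Lemma moebius_poly_product :
  moebius_poly (P *p Q) = moebius_poly P * moebius_poly Q.
Proof.
rewrite !moebius_polyE big_distrlr pair_big /=; apply: eq_big => // -[p q] _ /=.
rewrite big_distrlr pair_big_dep /=; apply: eq_big => [[p' q']|[p' q']] /=.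
  by rewrite leEprod.
rewrite leEprod => /andP[/= lep leq].
rewrite moebius_product /= -scalerAl -scalerAr scalerA -exprD; congr (_ *: 'X^_).
rewrite !product_rank /=; have := rank_le lep; have := rank_le leq.
move: (rank p) (rank q) (rank p') (rank q') => a b a' b'; lia.
Qed.

End Product.

Theorem proposition5p1 (F : fieldType) (dP dQ : Order.disp_t)
    (P : finRankedPOrderType dP) (Q : finRankedPOrderType dQ)
    (minP : exists! p : P, minimal p) (minQ : exists! q : Q, minimal q) :
  exists H : nat -> nat,
    is_hilbert_series (splitting_component F (P *p Q)) H /\
    is_series_quotient (fun n => (H n)%:Z)
      (1 - 'X) (1 - 'X * moebius_poly P * moebius_poly Q).
Proof.
have := splitting_hilbert_series F (product_unique_minimal minP minQ).
by rewrite moebius_poly_product mulrA.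
Qed.
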